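(* Let $X$ be a smooth connected variety over $\mathbb{C}$, $n\geq 2$ an integer, and $\tau_n:\mathcal{G}_{n+1}\to\mathcal{H}_n$ the canonical morphism of sheaves of groups on $X$. Then: 1. $\ker(\tau_n)\simeq T_X$. 2. Let $g\in H^1(X,\mathcal{H}_n)$ and let $L$ be the line bundle on $X$ associated to the primitive multiple scheme of multiplicity $n$ underlying $g$. Then $T_X^g\simeq T_X\otimes L^n$.
   Context: For an open $U\subset X$ and $m\geq 1$, $\mathcal{G}_m(U)$ is the group of automorphisms of the $\mathbb{C}$-algebra $\mathcal{O}_X(U)[t]/(t^m)$ which induce the identity on its quotient $\mathcal{O}_X(U)$ by $(t)$. $\mathcal{H}_n(U)$ is the set of pairs $(\phi,u)$ with $\phi\in\mathcal{G}_n(U)$ and $u\in\mathcal{O}_X(U)[t]/(t^n)$ such that $\phi(t)=ut$, with group law $(\phi',u')(\phi,u)=(\phi'\phi,u'\phi'(u))$. The morphism $\tau_n$ sends $\phi\in\mathcal{G}_{n+1}(U)$, with $\phi(t)=ut$ ($u$ well defined modulo $t^n$), to the pair consisting of the automorphism of $\mathcal{O}_X(U)[t]/(t^n)$ induced by $\phi$ and of $u$ modulo $t^n$. Primitive multiple schemes of multiplicity $n$ with support $X$ are the Cohen-Macaulay schemes $Y$ over $\mathbb{C}$ with $Y_{red}=X$, locally embeddable in smooth varieties of dimension $\dim(X)+1$, such that $n$ is the smallest integer with $\mathcal{I}_X^n=0$ ($\mathcal{I}_X=\mathcal{I}_{X,Y}$ the ideal sheaf of $X$ in $Y$); the associated line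 bundle is $L=\mathcal{I}_X/\mathcal{I}_X^2$. Their isomorphism classes are the elements of $H^1(X,\mathcal{G}_n)$. The elements of $H^1(X,\mathcal{H}_n)$ are the isomorphism classes of pairs $(Y,\mathbb{L})$, with $Y$ a primitive multiple scheme of multiplicity $n$ with support $X$ and $\mathbb{L}$ a line bundle on $Y$ extending the line bundle $\mathcal{I}_{X,Y}$ (which lives on the closed subscheme of $Y$ with ideal $\mathcal{I}_X^{n-1}$); the scheme $Y$ underlying the class of a cocycle $((\phi_{ij},u_{ij}))$ is given by the cocycle $(\phi_{ij})$ of $\mathcal{G}_n$, and $L$ is given by the cocycle of constant terms of the $u_{ij}$. $\mathcal{G}_{n+1}$ acts by conjugation on $\ker(\tau_n)\simeq T_X$, and this action factors through $\mathcal{H}_n$. If $g$ is represented by a cocycle $(h_{ij})$ of $\mathcal{H}_n$ for an open cover $(U_i)$, $T_X^g$ is the sheaf obtained by gluing the sheaves $T_{X|U_i}$ by means of the automorphisms of $T_{X|U_{ij}}$ defined by the action of $h_{ij}$: its sections are families $(\gamma_i)$, $\gamma_i\in T_X(U_i)$, with $\gamma_i=h_{ij}\cdot\gamma_j$. *)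

(* Defs.v *)
From HB Require Import structures.
From mathcomp Require Import all_boot all_algebra.
From mathcomp Require Import complex.
From mathcomp Require Import boolp classical_sets functions reals topology.
From mathcomp Require Import mpoly.

Set Implicit Arguments.
Unset Strict Implicit.
Unset Printing Implicit Defensive.

Import GRing.Theory.
Local Open Scope classical_set_scope.
Local Open Scope ring_scope.

Record opens (X : topologicalType) := Opens {
  oset :> set X;
  oset_open : open oset }.

Definition capo (X : topologicalType) (U V : opens X) : opens X :=
  Opens (openI (oset_open U) (oset_open V)).

Definition selt (T : Type) (A : set T) x (h : A x) : A := SigSub (mem_set h).

Definition sincl (T : Type) (V U : set T) (p : V `<=` U) (x : V) : U :=
  selt (p _ (set_valP x)).

(* Spaces with functions, in terms of which varieties over C = R[i] are       *)
(* defined as in Serre's FAC: the points are the closed points, and O_X is a  *)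
(* sheaf of complex valued functions.                                         *)
Record fspace (R : realType) := FSpace {
  pt :> topologicalType;
  reg : forall U : opens pt, set (U -> R[i]);
  reg_cst : forall U c, @reg U (cst c);
  regB : forall U f g, @reg U f -> @reg U g -> @reg U (f - g);
  regM : forall U f g, @reg U f -> @reg U g -> @reg U (f * g);
  reg_res : forall (U V : opens pt) (p : V `<=` U) f,
    @reg U f -> @reg V (f \o sincl p);
  reg_glue : forall (U : opens pt) f,
    (forall x : U, exists (V : opens pt) (p : V `<=` U),
       oset V (val x) /\ @reg V (f \o sincl p)) -> @reg U f }.

Arguments reg {R} X U _ : rename.

Section Variety.
Variables (R : realType).
Local Notation C := R[i].

Definition zclosed N (Z : set ('I_N -> C)) : Prop :=
  exists S : set {mpoly C[N]}, Z = [set z | forall p, S p -> p.@[z] = 0].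

Definition vanishes N (Z : set ('I_N -> C)) (p : {mpoly C[N]}) : Prop :=
  forall z, Z z -> p.@[z] = 0.

Variable X : fspace R.

(* c identifies U, as a space with functions, with the Zariski closed subset  *)
(* c @` U of C^N; the values of c outside U are irrelevant.                   *)
Definition affine_chart (U : opens X) N (c : X -> 'I_N -> C) : Prop :=
  [/\ forall x y, oset U x -> oset U y -> c x = c y -> x = y,
      zclosed (c @` oset U),
      forall V : set X, V `<=` U ->
        (open V <-> exists2 Z, zclosed Z & V = oset U `\` (c @^-1` Z))
    & forall (V : opens X) (f : V -> C), V `<=` U ->
        (reg X V f <->
         forall x : V, exists (W : opens X) (p q : {mpoly C[N]}),
           oset W (val x) /\
           (forall y : V, oset W (val y) ->
              q.@[c (val y)] != 0 /\
              f y = p.@[c (val y)] / q.@[c (val y)]))].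

(* Near c x, the ideal of c @` U is generated by polynomials whose            *)
(* differentials at c x are linearly independent.                             *)
Definition smooth_at (x : X) : Prop :=
  exists (U : opens X) N (c : X -> 'I_N -> C),
    [/\ affine_chart U c, oset U x
      & exists r (F : 'I_r -> {mpoly C[N]}) (q : {mpoly C[N]}),
        [/\ forall l, vanishes (c @` oset U) (F l),
            q.@[c x] != 0,
            forall p, vanishes (c @` oset U) p ->
              exists k (a : 'I_r -> {mpoly C[N]}),
                q ^+ k * p = \sum_(l < r) a l * F l
          & row_free (\matrix_(l < r, k < N) ((F l)^`M(k)).@[c x])]].

Record smooth_connected_variety : Prop := {
  scv_qc : exists m (U : 'I_m -> opens X) (N : 'I_m -> nat)
      (c : forall i, X -> 'I_(N i) -> C),
    (forall i, affine_chart (U i) (c i)) /\ \bigcup_i oset (U i) = setT;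
  (* the trace of the diagonal on a product of two affine open sets is closed *)
  scv_sep : forall (U V : opens X) N M (c : X -> 'I_N -> C) (d : X -> 'I_M -> C),
    affine_chart U c -> affine_chart V d ->
    zclosed [set z : 'I_(N + M) -> C | exists2 x, (oset U `&` oset V) x &
      z = fun k => match fintype.split k with inl i => c x i | inr j => d x j end];
  scv_smooth : forall x, smooth_at x;
  scv_conn : connected [set: X];
  scv_ne : [set: X] !=set0 }.

End Variety.

Section Ofun.
Variables (R : realType) (X : fspace R).

Definition regp (U : opens X) : {pred (U -> R[i])} :=
  mem (reg X U : set (U -> R[i])).
Arguments regp U _ : clear implicits.

Record ofun (U : opens X) := OFun {
  oval :> U -> R[i];
  ovalP : oval \in regp U }.

Section Ring.
Variable U : opens X.

Fact regp_subring : subring_closed (regp U).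
Proof.
split=> [|f g|f g].
- by apply/mem_set/reg_cst.
- by move=> /set_mem hf /set_mem hg; apply/mem_set/regB.
- by move=> /set_mem hf /set_mem hg; apply/mem_set/regM.
Qed.

HB.instance Definition _ := [isSub for (@oval U)].
HB.instance Definition _ := [Choice of ofun U by <:].
HB.instance Definition _ := 
  GRing.SubChoice_isSubComPzRing.Build _ (regp U) (ofun U) regp_subring.

Definition ocst (c : R[i]) : ofun U := OFun (mem_set (reg_cst U c)).

Definition ores (V : opens X) (p : V `<=` U) (f : ofun U) : ofun V :=
  OFun (mem_set (reg_res p (set_mem (ovalP f)))).

End Ring.

Lemma ofunP (U : opens X) (f g : ofun U) : (forall x, f x = g x) -> f = g.
Proof. by move=> h; apply/val_inj/funext. Qed.

Section Res.
Variables (U V : opens X) (p : V `<=` U).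

Lemma oresE (f : ofun U) (x : V) : ores p f x = f (sincl p x). Proof. by []. Qed.

Fact ores_zmod : zmod_morphism (ores p). Proof. by move=> f g; apply: ofunP. Qed.
Fact ores_monoid : monoid_morphism (ores p).
Proof. by split=> [|f g]; apply: ofunP. Qed.
HB.instance Definition _ :=
  GRing.isZmodMorphism.Build (ofun U) (ofun V) (ores p) ores_zmod.
HB.instance Definition _ :=
  GRing.isMonoidMorphism.Build (ofun U) (ofun V) (ores p) ores_monoid.

Lemma ores_cst c : ores p (ocst U c) = ocst V c. Proof. exact: ofunP. Qed.

End Res.

Lemma ores_id (U : opens X) (p : U `<=` U) f : ores p f = f.
Proof. by apply: ofunP => x; rewrite oresE; congr (f _); apply: val_inj. Qed.

Lemma ores_comp (U V W : opens X) (p : V `<=` U) (q : W `<=` V) (r : W `<=` U) f :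
  ores q (ores p f) = ores r f.
Proof. by apply: ofunP => x; rewrite !oresE; congr (f _); apply: val_inj. Qed.

Lemma ofun_sep (U : opens X) (I : Type) (W : I -> opens X)
    (p : forall i, W i `<=` U) (f g : ofun U) :
  oset U `<=` \bigcup_i oset (W i) ->
  (forall i, ores (p i) f = ores (p i) g) -> f = g.
Proof.
move=> cov h; apply: ofunP => x.
have [i _ Wx] := cov _ (set_valP x).
have /(congr1 (fun k : ofun (W i) => k (selt Wx))) := h i.
by rewrite !oresE (_ : sincl _ _ = x) //; apply: val_inj.
Qed.

Lemma ofun_glue (U : opens X) (I : Type) (W : I -> opens X)
    (p : forall i, W i `<=` U) (s : forall i, ofun (W i)) :
  oset U `<=` \bigcup_i oset (W i) ->
  (forall i j (V : opens X) (pi : V `<=` W i) (pj : V `<=` W j),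
     ores pi (s i) = ores pj (s j)) ->
  exists f : ofun U, forall i, ores (p i) f = s i.
Proof.
move=> cov h.
have pick (x : U) : {i | oset (W i) (val x)}.
  by apply/cid; have [i _ Wx] := cov _ (set_valP x); exists i.
pose f (x : U) := s (projT1 (pick x)) (@selt _ (oset (W _)) _ (projT2 (pick x))).
have fE i (y : W i) : f (sincl (p i) y) = s i y.
  rewrite /f; set x := sincl _ _; case: (pick x) => j /= Wjx.
  have pi : capo (W i) (W j) `<=` W i by apply: subIsetl.
  have pj : capo (W i) (W j) `<=` W j by apply: subIsetr.
  have Wy : oset (capo (W i) (W j)) (val y).
    by split => //; apply: set_valP.
  have /(congr1 (fun k : ofun _ => k (selt Wy))) := h _ _ _ pi pj.
  rewrite !oresE (_ : sincl _ _ = y); last exact: val_inj.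
  by move=> ->; congr (s j _); apply: val_inj.
have rf : reg X U f.
  apply: reg_glue => x; have [i _ Wx] := cov _ (set_valP x).
  exists (W i), (p i); split=> //.
  rewrite (_ : _ \o _ = s i :> (W i -> _)); last by apply: funext => y; apply: fE.
  exact: set_mem (ovalP (s i)).
by exists (OFun (mem_set rf)) => i; apply: ofunP => y; apply: fE.
Qed.

End Ofun.

Section Tpoly.
Variables (m : nat) (A : comPzRingType).

(* A[t]/(t^m), an element being given by its m coefficients *)
Definition tpoly := {ffun 'I_m -> A}.
HB.instance Definition _ := GRing.Zmodule.on tpoly.

Implicit Types f g h : tpoly.

Definition tmul f g : tpoly :=
  [ffun k : 'I_m => \sum_(i < m) \sum_(j < m | (i + j == k)%N) f i * g j].

(* the class of the constant a, and the class of t *)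
Definition tC (a : A) : tpoly := [ffun k : 'I_m => if val k == 0%N then a else 0].
Definition tX : tpoly := [ffun k : 'I_m => (val k == 1%N)%:R].

Lemma tpolyP f g : (forall k, f k = g k) -> f = g.
Proof. by move=> h; apply/ffunP. Qed.

Fact tmulC : commutative tmul.
Proof.
move=> f g; apply: tpolyP => k; rewrite !ffunE (exchange_big_dep predT) //=.
by apply: eq_bigr => i _; apply: eq_big => [j|j _]; rewrite ?(addnC i) // mulrC.
Qed.

Fact tmulDl : left_distributive tmul +%R.
Proof.
move=> f g h; apply: tpolyP => k; rewrite !ffunE -big_split /=.
apply: eq_bigr => i _; rewrite -big_split; apply: eq_bigr => j _ /=.
by rewrite ffunE mulrDl.
Qed.

Fact tmul1 : left_id (tC 1) tmul.
Proof.
move=> f; apply: tpolyP => k; rewrite ffunE.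
have m0 : (0 < m)%N by apply: leq_ltn_trans (ltn_ord k).
rewrite (bigD1 (Ordinal m0)) //= [X in _ + X]big1 ?addr0 => [|i i0].
  rewrite (bigD1 k) ?add0n //= big1 ?addr0 ?ffunE ?mul1r // => j /andP[/eqP jk].
  by rewrite -val_eqE /= -jk add0n eqxx.
apply: big1 => j _; rewrite ffunE ifN ?mul0r //.
Qed.

Lemma tmul3E f g h k : tmul (tmul f g) h k =
  \sum_(a < m) \sum_(b < m) \sum_(c < m)
    if (a + b + c == k)%N then f a * g b * h c else 0.
Proof.
rewrite ffunE.
transitivity (\sum_(l < m) \sum_(c < m | (l + c == k)%N)
    \sum_(a < m) \sum_(b < m | (a + b == l)%N) f a * g b * h c).
  apply: eq_bigr => l _; apply: eq_bigr => c _; rewrite ffunE mulr_suml.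
  by apply: eq_bigr => a _; rewrite mulr_suml.
under eq_bigr do rewrite exchange_big /=.
rewrite exchange_big /=; apply: eq_bigr => a _.
under eq_bigr do rewrite (exchange_big_dep predT) //=.
rewrite exchange_big /=; apply: eq_bigr => b _.
rewrite (exchange_big_dep predT) //=.
apply: eq_bigr => c _.
case: ifPn => [/eqP E|E].
  have lm : (a + b < m)%N by apply: leq_ltn_trans (ltn_ord k); rewrite -E leq_addr.
  rewrite (big_pred1 (Ordinal lm)) // => l /=.
  by rewrite -val_eqE /=; apply/andP/eqP => [[_ /eqP ->]|->] //; rewrite E !eqxx.
apply: big1 => l /andP[/eqP lk /eqP ab]; case/eqP: E; by rewrite ab lk.
Qed.

Fact tmulA : associative tmul.
Proof.
move=> f g h; rewrite [LHS]tmulC; apply: tpolyP => k; rewrite !tmul3E.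
under eq_bigr do rewrite exchange_big; rewrite exchange_big /=.
apply: eq_bigr => a _; apply: eq_bigr => b _; apply: eq_bigr => c _.
by rewrite [(b + c + a)%N]addnC addnA mulrC mulrA.
Qed.

HB.instance Definition _ :=
  GRing.Zmodule_isComPzRing.Build tpoly tmulA tmulC tmul1 tmulDl.

Lemma tmulE f g k : (f * g) k = \sum_(i < m) \sum_(j < m | (i + j == k)%N) f i * g j.
Proof. by rewrite [LHS]ffunE. Qed.

Lemma taddE f g k : (f + g) k = f k + g k. Proof. exact: ffunE. Qed.
Lemma toppE f k : (- f) k = - f k. Proof. exact: ffunE. Qed.
Lemma t0E k : (0 : tpoly) k = 0. Proof. exact: ffunE. Qed.
Lemma t1E : 1 = tC 1 :> tpoly. Proof. by []. Qed.

Lemma tCE a k : tC a k = if val k == 0%N then a else 0. Proof. exact: ffunE. Qed.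
Lemma tXE k : tX k = (val k == 1%N)%:R. Proof. exact: ffunE. Qed.

Lemma tCM_coef a f k : (tC a * f) k = a * f k.
Proof.
have m0 : (0 < m)%N by apply: leq_ltn_trans (ltn_ord k).
rewrite tmulE (bigD1 (Ordinal m0)) //= [X in _ + X]big1 ?addr0 => [|i i0].
  rewrite (bigD1 k) ?add0n //= big1 ?addr0 ?tCE // => j /andP[/eqP jk].
  by rewrite -val_eqE /= -jk add0n eqxx.
by apply: big1 => j _; rewrite tCE ifN ?mul0r.
Qed.

Lemma tXM_coef f (k l : 'I_m) : l.+1 = k :> nat -> (tX * f) k = f l.
Proof.
move=> lk; have m1 : (1 < m)%N.
  by apply: leq_ltn_trans (ltn_ord k); rewrite -lk.
rewrite tmulE (bigD1 (Ordinal m1)) //= [X in _ + X]big1 ?addr0 => [|i i1].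
  rewrite (bigD1 l) /= ?add1n ?lk //= big1 ?addr0 ?tXE ?mul1r // => j /andP[].
  by rewrite add1n -lk eqSS -val_eqE => ->.
by move: i1; rewrite -val_eqE /= => i1; apply: big1 => j _; rewrite tXE (negPf i1) mul0r.
Qed.

Lemma tXM_coef0 f (k : 'I_m) : k = 0%N :> nat -> (tX * f) k = 0.
Proof.
move=> k0; rewrite tmulE big1 // => i _; rewrite big1 // => j.
by rewrite k0 addn_eq0 => /andP[/eqP i0 _]; rewrite tXE /= i0 mul0r.
Qed.

Lemma tXn_coef n k : (tX ^+ n) k = (val k == n)%:R.
Proof.
elim: n k => [|n IH] k; first by rewrite expr0 t1E tCE; case: eqP.
rewrite exprS; case: (posnP k) => [k0|k0].
  by rewrite tXM_coef0 // /= k0.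
have lt : (k.-1 < m)%N by apply: leq_ltn_trans (leq_pred _) (ltn_ord k).
by rewrite (@tXM_coef _ _ (Ordinal lt)) /= ?prednK // IH /= -eqSS prednK.
Qed.

Definition in_t f := exists g, f = tX * g.

Lemma in_tP f : (forall k, val k = 0%N -> f k = 0) -> in_t f.
Proof.
move=> h; exists [ffun i : 'I_m => oapp f 0 (insub i.+1)].
apply: tpolyP => k; case: (posnP k) => [k0|k0]; first by rewrite h ?tXM_coef0.
have lt : (k.-1 < m)%N by apply: leq_ltn_trans (leq_pred _) (ltn_ord k).
rewrite (@tXM_coef _ _ (Ordinal lt)) /= ?prednK // ffunE /= prednK //.
by rewrite valK.
Qed.

Lemma in_t_coef0 f k : in_t f -> val k = 0%N -> f k = 0.
Proof. by case=> g -> ?; rewrite tXM_coef0. Qed.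

Lemma in_tN f : in_t f -> in_t (- f).
Proof. by case=> g ->; exists (- g); rewrite mulrN. Qed.

Lemma in_tD f g : in_t f -> in_t g -> in_t (f + g).
Proof. by case=> a -> [b ->]; exists (a + b); rewrite mulrDr. Qed.

Lemma in_t0 : in_t 0. Proof. by exists 0; rewrite mulr0. Qed.

End Tpoly.
Arguments tC m {A} a.
Arguments tX m A : clear implicits.

Section Tmap.
Variables (m : nat) (A B : comPzRingType) (r : {rmorphism A -> B}).

Definition tmap (f : tpoly m A) : tpoly m B := [ffun k => r (f k)].

Lemma tmapE f k : tmap f k = r (f k). Proof. exact: ffunE. Qed.

Fact tmap_zmod : zmod_morphism tmap.
Proof. by move=> f g; apply: tpolyP => k; rewrite taddE toppE !tmapE taddE toppE rmorphB. Qed.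
Fact tmap_monoid : monoid_morphism tmap.
Proof.
split=> [|f g]; apply: tpolyP => k; rewrite tmapE.
  by rewrite !t1E !tCE; case: ifP; rewrite ?rmorph1 ?rmorph0.
rewrite !tmulE rmorph_sum; apply: eq_bigr => i _.
by rewrite rmorph_sum; apply: eq_bigr => j _; rewrite rmorphM !tmapE.
Qed.
HB.instance Definition _ :=
  GRing.isZmodMorphism.Build (tpoly m A) (tpoly m B) tmap tmap_zmod.
HB.instance Definition _ :=
  GRing.isMonoidMorphism.Build (tpoly m A) (tpoly m B) tmap tmap_monoid.

Lemma tmapC a : tmap (tC m a) = tC m (r a).
Proof. by apply: tpolyP => k; rewrite tmapE !tCE; case: ifP; rewrite ?rmorph0. Qed.
Lemma tmapX : tmap (tX m A) = tX m B.
Proof. by apply: tpolyP => k; rewrite tmapE !tXE rmorph_nat. Qed.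
End Tmap.

Section Trunc.
Variables (n : nat) (A : comPzRingType).

Definition ttr (f : tpoly n.+1 A) : tpoly n A :=
  [ffun i => f (widen_ord (leqnSn n) i)].
(* a section of ttr, with coefficient 0 in degree n *)
Definition tlift (f : tpoly n A) : tpoly n.+1 A :=
  [ffun i : 'I_n.+1 => oapp f 0 (insub (val i))].

Lemma ttrE f k : ttr f k = f (widen_ord (leqnSn n) k). Proof. exact: ffunE. Qed.

Fact ttr_zmod : zmod_morphism ttr.
Proof. by move=> f g; apply: tpolyP => k; rewrite taddE toppE !ttrE taddE toppE. Qed.
Fact ttr_monoid : monoid_morphism ttr.
Proof.
split=> [|f g]; apply: tpolyP => k; rewrite ttrE; first by rewrite !t1E !tCE.
rewrite !tmulE big_ord_recr /= [X in _ + X]big1 ?addr0 => [|j]; last first.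
  by move=> /eqP E; have := ltn_ord k; rewrite -E ltnNge leq_addr.
apply: eq_bigr => i _; rewrite big_mkcond big_ord_recr /= ifN ?addr0; last first.
  by apply/eqP => E; have := ltn_ord k; rewrite -E ltnNge leq_addl.
by rewrite [RHS]big_mkcond; apply: eq_bigr => j _; rewrite !ttrE.
Qed.
HB.instance Definition _ :=
  GRing.isZmodMorphism.Build (tpoly n.+1 A) (tpoly n A) ttr ttr_zmod.
HB.instance Definition _ :=
  GRing.isMonoidMorphism.Build (tpoly n.+1 A) (tpoly n A) ttr ttr_monoid.

Lemma tliftK : cancel tlift ttr.
Proof. by move=> f; apply: tpolyP => k; rewrite ttrE ffunE /= valK. Qed.

Lemma ttrC a : ttr (tC _ a) = tC _ a.
Proof. by apply: tpolyP => k; rewrite ttrE !tCE. Qed.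
Lemma ttrX : ttr (tX _ A) = tX _ A.
Proof. by apply: tpolyP => k; rewrite ttrE !tXE. Qed.

Lemma ttr_eq0 f : ttr f = 0 -> f = tC _ (f ord_max) * tX _ A ^+ n.
Proof.
move=> h; apply: tpolyP => k; rewrite tCM_coef tXn_coef.
case: (eqVneq (val k) n) => [kn|kn].
  by rewrite mulr1; congr (f _); apply: val_inj.
have lt : (k < n)%N by have := ltn_ord k; rewrite ltnS leq_eqVlt (negPf kn).
rewrite mulr0; have /(congr1 (fun g : tpoly n A => g (Ordinal lt))) := h.
by rewrite ttrE t0E => <-; congr (f _); apply: val_inj.
Qed.

End Trunc.

#[local] Obligation Tactic := idtac.

Section Groups.
Variables (R : realType) (X : fspace R).

Section Gaut.
Variable m : nat.

(* G_m(U): automorphisms over U of the sheaf of C-algebras O_X[t]/(t^m),      *)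
(* inducing the identity modulo t. An automorphism of the algebra of sections *)
(* over U can be restricted to smaller open sets only when U is affine, and   *)
(* then it is the same thing. The inverse, which is determined, is recorded.  *)
Record gaut (U : opens X) := GAut {
  gfun : forall V : opens X, V `<=` U -> tpoly m (ofun V) -> tpoly m (ofun V);
  ginv : forall V : opens X, V `<=` U -> tpoly m (ofun V) -> tpoly m (ofun V);
  gfunK : forall (V : opens X) (p : V `<=` U), cancel (gfun p) (ginv p);
  ginvK : forall (V : opens X) (p : V `<=` U), cancel (ginv p) (gfun p);
  gfunD : forall (V : opens X) (p : V `<=` U), {morph gfun p : f g / f + g};
  gfunM : forall (V : opens X) (p : V `<=` U), {morph gfun p : f g / f * g};
  gfun_cst : forall (V : opens X) (p : V `<=` U) c,
    gfun p (tC m (ocst V c)) = tC m (ocst V c);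
  gfun_res : forall (V W : opens X) (p : V `<=` U) (q : W `<=` U) (r : W `<=` V) f,
    gfun q (tmap (ores r) f) = tmap (ores r) (gfun p f);
  gfun_modt : forall (V : opens X) (p : V `<=` U) f, in_t (gfun p f - f) }.

Section Group.
Variable U : opens X.

Lemma gautP (a b : gaut U) :
  (forall (V : opens X) (p : V `<=` U) f, gfun a p f = gfun b p f) -> a = b.
Proof.
move=> h.
have hf : @gfun _ a = @gfun _ b.
  by apply: functional_extensionality_dep => V; apply: functional_extensionality_dep => p;
     apply: funext => f.
have hi : @ginv _ a = @ginv _ b.
  apply: functional_extensionality_dep => V; apply: functional_extensionality_dep => p.
  by apply: funext => f; rewrite -{1}(ginvK b p f) -h gfunK.
case: a b h hf hi => [f i a1 a2 a3 a4 a5 a6 a7] [f' i' b1 b2 b3 b4 b5 b6 b7] /= _ ff ii.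
by subst; f_equal; apply: Prop_irrelevance.
Qed.

Lemma gfun_irr (a : gaut U) (V : opens X) (p q : V `<=` U) f : gfun a p f = gfun a q f.
Proof. by rewrite (Prop_irrelevance p q). Qed.

Program Definition gone : gaut U :=
  @GAut U (fun V p => id) (fun V p => id) _ _ _ _ _ _ _.
Next Obligation. by []. Qed.
Next Obligation. by []. Qed.
Next Obligation. by []. Qed.
Next Obligation. by []. Qed.
Next Obligation. by []. Qed.
Next Obligation. by []. Qed.
Next Obligation. by move=> V p f; rewrite subrr; apply: in_t0. Qed.

Program Definition gmul (a b : gaut U) : gaut U :=
  @GAut U (fun V p => gfun a p \o gfun b p) (fun V p => ginv b p \o ginv a p)
    _ _ _ _ _ _ _.
Next Obligation. by move=> a b V p f /=; rewrite !gfunK. Qed.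
Next Obligation. by move=> a b V p f /=; rewrite !ginvK. Qed.
Next Obligation. by move=> a b V p f g /=; rewrite !gfunD. Qed.
Next Obligation. by move=> a b V p f g /=; rewrite !gfunM. Qed.
Next Obligation. by move=> a b V p c /=; rewrite !gfun_cst. Qed.
Next Obligation. by move=> a b V W p q r f /=; rewrite !(gfun_res _ p). Qed.
Next Obligation.
move=> a b V p f /=; rewrite -(subrK (gfun b p f) (gfun a p _)) -addrA.
by apply: in_tD; apply: gfun_modt.
Qed.

Program Definition ginverse (a : gaut U) : gaut U :=
  @GAut U (@ginv _ a) (@gfun _ a) _ _ _ _ _ _ _.
Next Obligation. exact: ginvK. Qed.
Next Obligation. exact: gfunK. Qed.
Next Obligation.
by move=> a V p f g; apply: (can_inj (gfunK a p)); rewrite gfunD !ginvK.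
Qed.
Next Obligation.
by move=> a V p f g; apply: (can_inj (gfunK a p)); rewrite gfunM !ginvK.
Qed.
Next Obligation.
by move=> a V p c; apply: (can_inj (gfunK a p)); rewrite ginvK gfun_cst.
Qed.
Next Obligation.
move=> a V W p q r f.
by apply: (can_inj (gfunK a q)); rewrite ginvK (gfun_res _ p) ginvK.
Qed.
Next Obligation.
move=> a V p f; rewrite -[X in _ - X](ginvK a p) -opprB; apply: in_tN.
exact: gfun_modt.
Qed.

HB.instance Definition _ := gen_eqMixin (gaut U).
HB.instance Definition _ := gen_choiceMixin (gaut U).

Fact gmulA : associative gmul. Proof. by move=> a b c; apply: gautP. Qed.
Fact gmul1 : left_id gone gmul. Proof. by move=> a; apply: gautP. Qed.
Fact gmulr1 : right_id gone gmul. Proof. by move=> a; apply: gautP. Qed.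
Fact gmulV : left_inverse gone ginverse gmul.
Proof. by move=> a; apply: gautP => V p f /=; rewrite gfunK. Qed.
Fact gmulrV : right_inverse gone ginverse gmul.
Proof. by move=> a; apply: gautP => V p f /=; rewrite ginvK. Qed.
HB.instance Definition _ :=
  isGroup.Build (gaut U) gmulA gmul1 gmulr1 gmulV gmulrV.

Lemma gmulE (a b : gaut U) (V : opens X) (p : V `<=` U) f :
  gfun (a * b)%g p f = gfun a p (gfun b p f).
Proof. by []. Qed.

Lemma goneE (V : opens X) (p : V `<=` U) f : gfun (1%g : gaut U) p f = f.
Proof. by []. Qed.

Section Morph.
Variables (a : gaut U) (V : opens X) (p : V `<=` U).
Fact gfun_zmod : zmod_morphism (gfun a p).
Proof.
move=> f g; apply/eqP; rewrite eq_sym subr_eq -gfunD subrK //.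
Qed.
Fact gfun_monoid : monoid_morphism (gfun a p).
Proof.
split; last exact: gfunM.
have E : 1 = ocst V 1 :> ofun V by apply: ofunP.
by rewrite t1E E gfun_cst.
Qed.
End Morph.

Lemma gfun0 (a : gaut U) (V : opens X) (p : V `<=` U) : gfun a p 0 = 0.
Proof. by have := gfun_zmod a p 0 0; rewrite !subrr. Qed.

Lemma gfun1 (a : gaut U) (V : opens X) (p : V `<=` U) : gfun a p 1 = 1.
Proof. by case: (gfun_monoid a p). Qed.

Lemma gfunX (a : gaut U) (V : opens X) (p : V `<=` U) f n :
  gfun a p (f ^+ n) = gfun a p f ^+ n.
Proof.
elim: n => [|n IH]; first by rewrite !expr0 gfun1.
by rewrite !exprS gfunM IH.
Qed.

Lemma gfun_in_t (a : gaut U) (V : opens X) (p : V `<=` U) f :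
  in_t f -> in_t (gfun a p f).
Proof. by move=> h; rewrite -(subrK f (gfun a p f)); apply: in_tD h; apply: gfun_modt. Qed.

Lemma gfun_coef0 (a : gaut U) (V : opens X) (p : V `<=` U) f k :
  val k = 0%N -> gfun a p f k = f k.
Proof.
move=> k0; have := in_t_coef0 (gfun_modt a p f) k0.
by rewrite taddE toppE => /eqP; rewrite subr_eq0 => /eqP.
Qed.

End Group.

Program Definition gres (U V : opens X) (p : V `<=` U) (a : gaut U) : gaut V :=
  @GAut V (fun W q => gfun a (subset_trans q p)) (fun W q => ginv a (subset_trans q p))
    _ _ _ _ _ _ _.
Next Obligation. by move=> U V p a W q; apply: gfunK. Qed.
Next Obligation. by move=> U V p a W q; apply: ginvK. Qed.
Next Obligation. by move=> U V p a W q; apply: gfunD. Qed.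
Next Obligation. by move=> U V p a W q; apply: gfunM. Qed.
Next Obligation. by move=> U V p a W q; apply: gfun_cst. Qed.
Next Obligation. by move=> U V p a W W' q q' r f; apply: gfun_res. Qed.
Next Obligation. by move=> U V p a W q; apply: gfun_modt. Qed.

End Gaut.

Section Hpair.
Variable n : nat.

Record hpair (U : opens X) := HPair {
  haut : gaut n U;
  hu : tpoly n (ofun U);
  haut_t : gfun haut (@subset_refl _ U) (tX n _) = hu * tX n _ }.

Section Monoid.
Variable U : opens X.
Local Notation id_U := (@subset_refl _ (U : set X)).

Lemma hpairP (h k : hpair U) : haut h = haut k -> hu h = hu k -> h = k.
Proof.
case: h k => [a u e] [a' u' e'] /= aa uu; subst.
by f_equal; apply: Prop_irrelevance.
Qed.

Program Definition hone : hpair U := @HPair U 1%g 1 _.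
Next Obligation. by rewrite mul1r. Qed.

Program Definition hmul (h' h : hpair U) : hpair U :=
  @HPair U (haut h' * haut h)%g (hu h' * gfun (haut h') id_U (hu h)) _.
Next Obligation. by move=> h' h /=; rewrite haut_t gfunM haut_t mulrCA mulrA. Qed.

HB.instance Definition _ := gen_eqMixin (hpair U).
HB.instance Definition _ := gen_choiceMixin (hpair U).

Fact hmulA : associative hmul.
Proof.
by move=> a b c; apply: hpairP => /=; rewrite ?mulgA // gfunM mulrA.
Qed.
Fact hmul1 : left_id hone hmul.
Proof. by move=> a; apply: hpairP => /=; rewrite ?mul1g // mul1r. Qed.
Fact hmulr1 : right_id hone hmul.
Proof.
move=> a; apply: hpairP => /=; rewrite ?mulg1 //.
by rewrite gfun1 mulr1.
Qed.
(* inverses exist when 2 <= n, u being then invertible *)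
HB.instance Definition _ := isMonoid.Build (hpair U) hmulA hmul1 hmulr1.

End Monoid.

Program Definition hres (U V : opens X) (p : V `<=` U) (h : hpair U) : hpair V :=
  @HPair V (gres p (haut h)) (tmap (ores p) (hu h)) _.
Next Obligation.
move=> U V p h /=; have := congr1 (tmap (ores p)) (haut_t h).
rewrite rmorphM /= tmapX => <-.
by rewrite -(@gfun_res _ _ (haut h) _ _ _ (subset_trans (@subset_refl _ _) p)) tmapX.
Qed.

End Hpair.

Section Tau.
Variable n : nat.
Variable U : opens X.
Implicit Type a : gaut n.+1 U.

Lemma ttr_gfun a (V : opens X) (p : V `<=` U) f g :
  ttr f = ttr g -> ttr (gfun a p f) = ttr (gfun a p g).
Proof.
move=> fg; apply/eqP; rewrite -subr_eq0 -rmorphB -gfun_zmod.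
have /ttr_eq0 -> : ttr (f - g) = 0 by rewrite rmorphB /= fg subrr.
have [h ht] : in_t (gfun a p (tX _ _)).
  by apply: gfun_in_t; exists 1; rewrite mulr1.
rewrite gfunM gfunX ht rmorphM rmorphXn rmorphM /= ttrX exprMn.
rewrite (_ : tX n _ ^+ n = 0) ?mul0r ?mulr0 //.
by apply: tpolyP => k; rewrite tXn_coef t0E /= (ltn_eqF (ltn_ord k)).
Qed.

(* the automorphism induced modulo t^n *)
Program Definition gtr a : gaut n U :=
  @GAut n U (fun V p f => ttr (gfun a p (tlift f))) (fun V p f => ttr (ginv a p (tlift f)))
    _ _ _ _ _ _ _.
Next Obligation.
move=> a V p f; rewrite -[RHS]tliftK -[in RHS](gfunK a p (tlift f)).
by apply: (@ttr_gfun a^-1%g); rewrite tliftK.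
Qed.
Next Obligation.
move=> a V p f; rewrite -[RHS]tliftK -[in RHS](ginvK a p (tlift f)).
by apply: ttr_gfun; rewrite tliftK.
Qed.
Next Obligation.
move=> a V p f g; rewrite -rmorphD -gfunD; apply: ttr_gfun.
by rewrite rmorphD /= !tliftK.
Qed.
Next Obligation.
move=> a V p f g; rewrite -rmorphM -gfunM; apply: ttr_gfun.
by rewrite rmorphM /= !tliftK.
Qed.
Next Obligation.
move=> a V p c; rewrite -ttrC -[in RHS](gfun_cst a p); apply: ttr_gfun.
by rewrite tliftK.
Qed.
Next Obligation.
move=> a V W p q r f; have ttr_tmap (A B : comPzRingType) (s : {rmorphism A -> B}) (g : tpoly n.+1 A) :
    ttr (tmap s g) = tmap s (ttr g).
  by apply: tpolyP => k; rewrite ttrE !tmapE ttrE.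
rewrite -ttr_tmap -(gfun_res a p q); apply: ttr_gfun.
by rewrite ttr_tmap !tliftK.
Qed.
Next Obligation.
move=> a V p f; apply: in_tP => k k0; rewrite taddE toppE ttrE gfun_coef0 //.
by rewrite -ttrE tliftK subrr.
Qed.

(* Writing a(t) = ut, the coefficients of u modulo t^n are those of a(t) in   *)
(* degrees 1, ..., n.                                                         *)
Program Definition tau a : hpair n U :=
  @HPair n U (gtr a)
    [ffun k : 'I_n => gfun a (@subset_refl _ U) (tX _ _) (lift ord0 k)] _.
Next Obligation.
move=> a; transitivity (ttr (gfun a (@subset_refl _ U) (tX n.+1 _))).
  by apply: ttr_gfun; rewrite tliftK ttrX.
rewrite mulrC; apply: tpolyP => k; rewrite ttrE; case: (posnP k) => [k0|k0].
  rewrite tXM_coef0 //; apply: in_t_coef0 => //.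
  by apply: gfun_in_t; exists 1; rewrite mulr1.
have lt : (k.-1 < n)%N by apply: leq_ltn_trans (leq_pred _) (ltn_ord k).
rewrite (@tXM_coef _ _ _ _ (Ordinal lt)) /= ?prednK // ffunE.
by congr (_ _); apply: val_inj; rewrite /= /bump add1n prednK.
Qed.

End Tau.

Lemma hres_comp n (U V W : opens X) (p : V `<=` U) (q : W `<=` V) (r : W `<=` U)
  (g : hpair n U) : hres q (hres p g) = hres r g.
Proof.
apply: hpairP; first by apply: gautP => B' b f /=; apply: gfun_irr.
by apply: tpolyP => l; rewrite /= !tmapE /= (ores_comp _ _ r).
Qed.

Lemma tau_res n (U V : opens X) (p : V `<=` U) (a : gaut n.+1 U) :
  tau (gres p a) = hres p (tau a).
Proof.
apply: hpairP; first by apply: gautP => B' b f.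
apply: tpolyP => l; rewrite /= ffunE tmapE ffunE -tmapE.
by rewrite -(@gfun_res _ _ a _ _ _ (subset_trans (@subset_refl _ _) p)) tmapX.
Qed.

Record omod := OMod {
  osec : forall U : opens X, lmodType (ofun U);
  mres : forall U V : opens X, V `<=` U -> osec U -> osec V;
  mresD : forall (U V : opens X) (p : V `<=` U), {morph mres p : s s' / s + s'};
  mresZ : forall (U V : opens X) (p : V `<=` U) a s,
    mres p (a *: s) = ores p a *: mres p s;
  mres_id : forall (U : opens X) (p : U `<=` U) s, mres p s = s;
  mres_comp : forall (U V W : opens X) (p : V `<=` U) (q : W `<=` V) (r : W `<=` U) s,
    mres q (mres p s) = mres r s;
  mres_sep : forall (U : opens X) (I : Type) (W : I -> opens X)
    (p : forall i, W i `<=` U) s s',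
    oset U `<=` \bigcup_i oset (W i) ->
    (forall i, mres (p i) s = mres (p i) s') -> s = s';
  mres_glue : forall (U : opens X) (I : Type) (W : I -> opens X)
    (p : forall i, W i `<=` U) (s : forall i, osec (W i)),
    oset U `<=` \bigcup_i oset (W i) ->
    (forall i j (V : opens X) (pi : V `<=` W i) (pj : V `<=` W j),
       mres pi (s i) = mres pj (s j)) ->
    exists s' : osec U, forall i, mres (p i) s' = s i }.

Definition OX : omod :=
  @OMod (fun U => (ofun U)^o) (fun U V p => ores p)
    (fun U V p => rmorphD (ores p)) (fun U V p => rmorphM (ores p))
    (@ores_id R X) (@ores_comp R X) (@ofun_sep R X) (@ofun_glue R X).

Section Tangent.

(* C-derivations of the sheaf O_X over U *)
Record tsec (U : opens X) := TSec {
  tfun : forall V : opens X, V `<=` U -> ofun V -> ofun V;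
  tfunD : forall (V : opens X) (p : V `<=` U), {morph tfun p : f g / f + g};
  tfunZ : forall (V : opens X) (p : V `<=` U) c f,
    tfun p (ocst V c * f) = ocst V c * tfun p f;
  tfunM : forall (V : opens X) (p : V `<=` U) f g,
    tfun p (f * g) = f * tfun p g + tfun p f * g;
  tfun_res : forall (V W : opens X) (p : V `<=` U) (q : W `<=` U) (r : W `<=` V) f,
    tfun q (ores r f) = ores r (tfun p f) }.

Section Lmod.
Variable U : opens X.

Lemma tsecP (D D' : tsec U) :
  (forall (V : opens X) (p : V `<=` U) f, tfun D p f = tfun D' p f) -> D = D'.
Proof.
move=> h.
have hf : @tfun _ D = @tfun _ D'.
  by apply: functional_extensionality_dep => V; apply: functional_extensionality_dep => p;
     apply: funext => f.
case: D D' h hf => [f a1 a2 a3 a4] [f' b1 b2 b3 b4] /= _ ff.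
by subst; f_equal; apply: Prop_irrelevance.
Qed.

Lemma tfun_irr (D : tsec U) (V : opens X) (p q : V `<=` U) f : tfun D p f = tfun D q f.
Proof. by rewrite (Prop_irrelevance p q). Qed.

HB.instance Definition _ := gen_eqMixin (tsec U).
HB.instance Definition _ := gen_choiceMixin (tsec U).

Program Definition tzero : tsec U := @TSec U (fun V p f => 0) _ _ _ _.
Next Obligation. by move=> V p f g /=; rewrite addr0. Qed.
Next Obligation. by move=> V p c f /=; rewrite mulr0. Qed.
Next Obligation. by move=> V p f g /=; rewrite mulr0 mul0r addr0. Qed.
Next Obligation. by move=> V W p q r f /=; rewrite rmorph0. Qed.

Program Definition topp (D : tsec U) : tsec U :=
  @TSec U (fun V p f => - tfun D p f) _ _ _ _.
Next Obligation. by move=> D V p f g /=; rewrite tfunD opprD. Qed.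
Next Obligation. by move=> D V p c f /=; rewrite tfunZ mulrN. Qed.
Next Obligation. by move=> D V p f g /=; rewrite tfunM opprD mulrN mulNr. Qed.
Next Obligation. by move=> D V W p q r f /=; rewrite (tfun_res _ p) rmorphN. Qed.

Program Definition tadd (D D' : tsec U) : tsec U :=
  @TSec U (fun V p f => tfun D p f + tfun D' p f) _ _ _ _.
Next Obligation. by move=> D D' V p f g /=; rewrite !tfunD addrACA. Qed.
Next Obligation. by move=> D D' V p c f /=; rewrite !tfunZ mulrDr. Qed.
Next Obligation.
by move=> D D' V p f g /=; rewrite !tfunM mulrDr mulrDl addrACA.
Qed.
Next Obligation. by move=> D D' V W p q r f /=; rewrite !(tfun_res _ p) rmorphD. Qed.

Program Definition tscale (a : ofun U) (D : tsec U) : tsec U :=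
  @TSec U (fun V p f => ores p a * tfun D p f) _ _ _ _.
Next Obligation. by move=> a D V p f g /=; rewrite tfunD mulrDr. Qed.
Next Obligation. by move=> a D V p c f /=; rewrite tfunZ mulrCA. Qed.
Next Obligation. by move=> a D V p f g /=; rewrite tfunM mulrDr mulrCA; congr (_ + _); rewrite mulrA. Qed.
Next Obligation.
by move=> a D V W p q r f /=; rewrite (tfun_res _ p) rmorphM /= (ores_comp p r q).
Qed.

Fact taddA : associative tadd.
Proof. by move=> D E F; apply: tsecP => V p f /=; rewrite addrA. Qed.
Fact taddC : commutative tadd.
Proof. by move=> D E; apply: tsecP => V p f /=; rewrite addrC. Qed.
Fact tadd0 : left_id tzero tadd.
Proof. by move=> D; apply: tsecP => V p f /=; rewrite add0r. Qed.
Fact taddN : left_inverse tzero topp tadd.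
Proof. by move=> D; apply: tsecP => V p f /=; rewrite addNr. Qed.
HB.instance Definition _ := GRing.isZmodule.Build (tsec U) taddA taddC tadd0 taddN.

Fact tscaleA a b D : tscale a (tscale b D) = tscale (a * b) D.
Proof. by apply: tsecP => V p f /=; rewrite rmorphM mulrA. Qed.
Fact tscale1 : left_id 1 tscale.
Proof. by move=> D; apply: tsecP => V p f /=; rewrite rmorph1 mul1r. Qed.
Fact tscaleDr : right_distributive tscale +%R.
Proof. by move=> a D E; apply: tsecP => V p f /=; rewrite mulrDr. Qed.
Fact tscaleDl D : {morph tscale^~ D : a b / a + b}.
Proof. by move=> a b; apply: tsecP => V p f /=; rewrite rmorphD mulrDl. Qed.
HB.instance Definition _ :=
  GRing.Zmodule_isLmodule.Build (ofun U) (tsec U) tscaleA tscale1 tscaleDr tscaleDl.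

Lemma taddfE (D E : tsec U) (V : opens X) (p : V `<=` U) f :
  tfun (D + E) p f = tfun D p f + tfun E p f.
Proof. by []. Qed.

Lemma tscalefE a (D : tsec U) (V : opens X) (p : V `<=` U) f :
  tfun (a *: D) p f = ores p a * tfun D p f.
Proof. by []. Qed.

End Lmod.

Program Definition tres (U V : opens X) (p : V `<=` U) (D : tsec U) : tsec V :=
  @TSec V (fun W q => tfun D (subset_trans q p)) _ _ _ _.
Next Obligation. by move=> U V p D W q; apply: tfunD. Qed.
Next Obligation. by move=> U V p D W q; apply: tfunZ. Qed.
Next Obligation. by move=> U V p D W q; apply: tfunM. Qed.
Next Obligation. by move=> U V p D W W' q q' r f; apply: tfun_res. Qed.

Fact tresD (U V : opens X) (p : V `<=` U) : {morph tres p : D E / D + E}.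
Proof. by move=> D E; apply: tsecP. Qed.
Fact tresZ (U V : opens X) (p : V `<=` U) a D :
  tres p (a *: D) = ores p a *: tres p D.
Proof. by apply: tsecP => W q f /=; rewrite (ores_comp p q (subset_trans q p)). Qed.
Fact tres_id (U : opens X) (p : U `<=` U) D : tres p D = D.
Proof. by apply: tsecP => V q f /=; apply: tfun_irr. Qed.
Fact tres_comp (U V W : opens X) (p : V `<=` U) (q : W `<=` V) (r : W `<=` U) D :
  tres q (tres p D) = tres r D.
Proof. by apply: tsecP => V' q' f /=; apply: tfun_irr. Qed.

Lemma capo_cov (U V : opens X) (I : Type) (W : I -> opens X) :
  V `<=` U -> oset U `<=` \bigcup_i oset (W i) ->
  oset V `<=` \bigcup_i oset (capo V (W i)).
Proof. by move=> p cov x Vx; have [i _ Wx] := cov _ (p _ Vx); exists i. Qed.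

Fact tres_sep (U : opens X) (I : Type) (W : I -> opens X)
    (p : forall i, W i `<=` U) (D D' : tsec U) :
  oset U `<=` \bigcup_i oset (W i) ->
  (forall i, tres (p i) D = tres (p i) D') -> D = D'.
Proof.
move=> cov h; apply: tsecP => V q f.
have pV i : capo V (W i) `<=` V by apply: subIsetl.
have pW i : capo V (W i) `<=` W i by apply: subIsetr.
apply: (ofun_sep (p := pV)) (capo_cov q cov) _ => i.
rewrite -!(tfun_res _ q (subset_trans (pW i) (p i))).
exact: (congr1 (fun E => tfun E (pW i) (ores (pV i) f)) (h i)).
Qed.

Section Glue.
Variables (U : opens X) (I : Type) (W : I -> opens X).
Variables (p : forall i, W i `<=` U) (s : forall i, tsec (W i)).
Hypothesis cov : oset U `<=` \bigcup_i oset (W i).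
Hypothesis hs : forall i j (V : opens X) (pi : V `<=` W i) (pj : V `<=` W j),
  tres pi (s i) = tres pj (s j).

Let hsf i j (V : opens X) (pi : V `<=` W i) (pj : V `<=` W j) f :
  tfun (s i) pi f = tfun (s j) pj f.
Proof.
have /(congr1 (fun E => tfun E (@subset_refl _ V) f)) := hs pi pj.
by rewrite /= => E; rewrite (tfun_irr _ _ (subset_trans (@subset_refl _ V) pi)) E;
   apply: tfun_irr.
Qed.

Definition tglue_spec (V : opens X) (f g : ofun V) :=
  forall i (V' : opens X) (a : V' `<=` V) (b : V' `<=` W i),
    ores a g = tfun (s i) b (ores a f).

Lemma tglue_ex (V : opens X) (q : V `<=` U) f : exists g, @tglue_spec V f g.
Proof.
have pV i : capo V (W i) `<=` V by apply: subIsetl.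
have pW i : capo V (W i) `<=` W i by apply: subIsetr.
have [|g hg] := @ofun_glue _ _ _ _ _ pV
    ( fun i => tfun (s i) (pW i) (ores (pV i) f)) (capo_cov q cov).
  move=> i j V' pi pj.
  rewrite -(tfun_res (s i) (pW i) (subset_trans pi (pW i))).
  rewrite -(tfun_res (s j) (pW j) (subset_trans pj (pW j))).
  rewrite !(ores_comp _ _ (subset_trans pi (pV i))).
  exact: hsf.
exists g => i V' a b.
have c : V' `<=` capo V (W i) by move=> x V'x; split; [apply: a|apply: b].
rewrite -(ores_comp (pV i) c a) hg -(tfun_res (s i) (pW i) b).
by rewrite (ores_comp _ _ a).
Qed.

Lemma tglue_uniq (V : opens X) (q : V `<=` U) f g g' :
  @tglue_spec V f g -> tglue_spec f g' -> g = g'.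
Proof.
have pV i : capo V (W i) `<=` V by apply: subIsetl.
have pW i : capo V (W i) `<=` W i by apply: subIsetr.
move=> h h'; apply: (ofun_sep (p := pV)) (capo_cov q cov) _ => i.
by rewrite (h i _ (pV i) (pW i)) (h' i _ (pV i) (pW i)).
Qed.

Let G (V : opens X) (q : V `<=` U) f := projT1 (cid (tglue_ex q f)).
Let GP (V : opens X) (q : V `<=` U) f : tglue_spec f (G q f).
Proof. exact: projT2 (cid (tglue_ex q f)). Qed.

Fact tres_glue : exists s' : tsec U, forall i, tres (@p i) s' = s i.
Proof.
have GD (V : opens X) (q : V `<=` U) : {morph G q : f g / f + g}.
  move=> f g; apply: (tglue_uniq q (GP q _)) => i V' a b.
  by rewrite !rmorphD /= !(GP q _ a b) tfunD.
have GZ (V : opens X) (q : V `<=` U) c f :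
    G q (ocst V c * f) = ocst V c * G q f.
  apply: (tglue_uniq q (GP q _)) => i V' a b.
  by rewrite !rmorphM /= !(GP q _ a b) ores_cst tfunZ.
have GM (V : opens X) (q : V `<=` U) f g :
    G q (f * g) = f * G q g + G q f * g.
  apply: (tglue_uniq q (GP q _)) => i V' a b.
  by rewrite rmorphD !rmorphM /= !(GP q _ a b) tfunM.
have GR (V V' : opens X) (q : V `<=` U) (q' : V' `<=` U) (r : V' `<=` V) f :
    G q' (ores r f) = ores r (G q f).
  apply: (tglue_uniq q' (GP q' _)) => i V'' a b.
  by rewrite !(ores_comp r a (subset_trans a r)) (GP q _ _ b).
exists (TSec GD GZ GM GR) => i; apply: tsecP => V q f /=.
have := GP (subset_trans q (@p i)) f (@subset_refl _ V) q.
by rewrite !ores_id.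
Qed.

End Glue.

Definition TX : omod :=
  @OMod tsec tres tresD tresZ tres_id tres_comp tres_sep tres_glue.

End Tangent.

Section Iota.
Variables (n : nat) (hn : (1 < n)%N).

Lemma tXn_mul (A : comPzRingType) (h : tpoly n.+1 A) :
  tX n.+1 A ^+ n * h = tC _ (h ord0) * tX n.+1 A ^+ n.
Proof.
have [g hg] : in_t (h - tC n.+1 (h ord0)).
  apply: in_tP => k k0; rewrite taddE toppE tCE k0 eqxx.
  by rewrite (_ : k = ord0) ?subrr //; apply: val_inj.
rewrite -[in LHS](subrK (tC n.+1 (h ord0)) h) hg mulrDr mulrA -exprSr.
rewrite (_ : tX _ _ ^+ n.+1 = 0) ?mul0r ?add0r 1?mulrC //.
by apply: tpolyP => k; rewrite tXn_coef t0E /= (ltn_eqF (ltn_ord k)).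
Qed.

Lemma tCXn_inj (A : comPzRingType) (a b : A) :
  tC n.+1 a * tX n.+1 A ^+ n = tC _ b * tX n.+1 A ^+ n -> a = b.
Proof.
move=> /(congr1 (fun f : tpoly n.+1 A => f ord_max)).
by rewrite !tCM_coef !tXn_coef /= eqxx !mulr1.
Qed.

Lemma tCD (A : comPzRingType) m (a b : A) : tC m (a + b) = tC m a + tC m b.
Proof. by apply: tpolyP => k; rewrite taddE !tCE; case: ifP; rewrite ?addr0. Qed.
Lemma tCN (A : comPzRingType) m (a : A) : tC m (- a) = - tC m a.
Proof. by apply: tpolyP => k; rewrite toppE !tCE; case: ifP; rewrite ?oppr0. Qed.
Lemma tCM (A : comPzRingType) m (a b : A) : tC m (a * b) = tC m a * tC m b.
Proof. by apply: tpolyP => k; rewrite tCM_coef !tCE; case: ifP; rewrite ?mulr0. Qed.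

Lemma tcoef0M (A : comPzRingType) (f g : tpoly n.+1 A) :
  (f * g) ord0 = f ord0 * g ord0.
Proof.
rewrite tmulE (bigD1 ord0) //= [X in _ + X]big1 ?addr0 => [|i i0].
  by rewrite (big_pred1 ord0) // => j; rewrite add0n.
rewrite big1 // => j; rewrite addn_eq0 => /andP[i00 _].
by move: i0; rewrite -val_eqE /= i00.
Qed.

Lemma tcoef0X (A : comPzRingType) (f : tpoly n.+1 A) k :
  (f ^+ k) ord0 = f ord0 ^+ k.
Proof.
elim: k => [|k IH]; first by rewrite !expr0 t1E tCE.
by rewrite !exprS tcoef0M IH.
Qed.

Variable U : opens X.
Implicit Type D : tsec U.

Definition iota_fun D (V : opens X) (p : V `<=` U) (f : tpoly n.+1 (ofun V)) :=
  f + tC n.+1 (tfun D p (f ord0)) * tX n.+1 _ ^+ n.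

Lemma iota_fun0 D (V : opens X) (p : V `<=` U) f : iota_fun D p f ord0 = f ord0.
Proof.
rewrite taddE tCM_coef tXn_coef /= (_ : (0 == n)%N = false) ?mulr0 ?addr0 //.
by rewrite ltn_eqF // (ltn_trans _ hn).
Qed.

Lemma tfun0 D (V : opens X) (p : V `<=` U) : tfun D p 0 = 0.
Proof. by apply: (addrI (tfun D p 0)); rewrite -tfunD !addr0. Qed.

Lemma tfun_cst D (V : opens X) (p : V `<=` U) c : tfun D p (ocst V c) = 0.
Proof.
have E : 1 = ocst V 1 :> ofun V by apply: ofunP.
rewrite -[ocst V c]mulr1 tfunZ; suff -> : tfun D p 1 = 0 by rewrite mulr0.
by apply: (addrI (tfun D p 1)); rewrite addr0 -{3}[1]mulr1 tfunM mulr1 mul1r.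
Qed.

Lemma iota_funK D (V : opens X) (p : V `<=` U) :
  cancel (iota_fun D p) (iota_fun (- D) p).
Proof.
move=> f; rewrite {1}/iota_fun iota_fun0 /iota_fun /=.
by rewrite tCN mulNr addrK.
Qed.

(* the automorphism fixing t and mapping each f in O_X to f + D(f) t^n *)
Program Definition iotaT D : gaut n.+1 U :=
  @GAut n.+1 U (@iota_fun D) (@iota_fun (- D)) _ _ _ _ _ _ _.
Next Obligation. move=> D V p; exact: iota_funK. Qed.
Next Obligation. by move=> D V p; have := iota_funK (- D) p; rewrite opprK. Qed.
Next Obligation.
move=> D V p f g; rewrite /iota_fun taddE tfunD tCD mulrDl.
by rewrite addrACA.
Qed.
Next Obligation.
move=> D V p f g; rewrite /iota_fun tcoef0M tfunM tCD !tCM.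
set a := tfun D p (f ord0); set b := tfun D p (g ord0).
have E1 (h : tpoly n.+1 (ofun V)) c :
    h * (tC _ c * tX _ _ ^+ n) = tC _ (h ord0) * tC _ c * tX _ _ ^+ n.
  by rewrite mulrCA [h * _]mulrC tXn_mul mulrCA mulrA.
have E2 : tC _ a * tX _ _ ^+ n * (tC _ b * tX n.+1 (ofun V) ^+ n) = 0.
  rewrite E1 tCM_coef tXn_coef /=.
  rewrite (_ : (0 == n)%N = false); last by rewrite ltn_eqF // (ltn_trans _ hn).
  rewrite mulr0 (_ : tC n.+1 (0 : ofun V) = 0) ?mul0r //.
  by apply: tpolyP => k; rewrite tCE t0E; case: ifP.
rewrite [RHS]mulrDr !mulrDl E2 addr0 E1 [_ * _ * g]mulrC E1 -!addrA.
by congr (_ + _); rewrite addrC [tC _ a * tC _ _]mulrC.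
Qed.
Next Obligation.
move=> D V p c; rewrite /iota_fun tCE /= tfun_cst.
rewrite (_ : tC n.+1 (0 : ofun V) = 0) ?mul0r ?addr0 //.
by apply: tpolyP => k; rewrite tCE t0E; case: ifP.
Qed.
Next Obligation.
move=> D V W p q r f; rewrite /iota_fun tmapE (tfun_res _ p) rmorphD rmorphM.
by rewrite rmorphXn /= tmapX tmapC.
Qed.
Next Obligation.
move=> D V p f; rewrite /iota_fun addrAC subrr add0r.
apply: in_tP => k k0; rewrite tCM_coef tXn_coef k0.
by rewrite (_ : (0 == n)%N = false) ?mulr0 // ltn_eqF // (ltn_trans _ hn).
Qed.

Lemma iotaE D (V : opens X) (p : V `<=` U) f :
  gfun (iotaT D) p f = f + tC n.+1 (tfun D p (f ord0)) * tX n.+1 _ ^+ n.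
Proof. by []. Qed.

Lemma iotaD D E : iotaT (D + E) = (iotaT D * iotaT E)%g.
Proof.
apply: gautP => V p f; rewrite gmulE [in RHS]iotaE.
rewrite -[gfun (iotaT E) p f]/(iota_fun E p f) iota_fun0 /iota_fun.
by rewrite iotaE taddfE tCD mulrDl [tC _ (tfun D _ _) * _ + _]addrC addrA.
Qed.

Lemma iota0 : iotaT 0 = 1%g.
Proof. by apply: (mulgI (iotaT 0)); rewrite -iotaD addr0 mulg1. Qed.

Lemma iota_inj D E : iotaT D = iotaT E -> D = E.
Proof.
move=> h; apply: tsecP => V p f.
have /(congr1 (fun a => gfun a p (tC n.+1 f))) := h.
by rewrite !iotaE => /addrI /tCXn_inj; rewrite !tCE.
Qed.

Lemma iota_conj (a : gaut n.+1 U) D :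
  (a * iotaT D * a^-1)%g =
  iotaT (gfun a (@subset_refl _ U) (tX _ _) (inord 1) ^+ n *: D).
Proof.
apply: (mulIg a); rewrite mulgVK; apply: gautP => V p f.
rewrite [LHS]gmulE [RHS]gmulE [RHS]iotaE [gfun (iotaT D) p f]iotaE.
rewrite gfunD gfunM (gfunX a p (tX _ _) n) tscalefE.
rewrite (gfun_coef0 a p f (erefl : val ord0 = 0%N)).
apply: (congr1 (fun z => gfun a p f + z)).
set c := tfun D p (f ord0).
have [g hg] : in_t (gfun a p (tX _ _)) by apply: gfun_in_t; exists 1; rewrite mulr1.
have gres : gfun a p (tX _ _) = tmap (ores p) (gfun a (@subset_refl _ U) (tX _ _)).
  by rewrite -(gfun_res a _ p) tmapX.
have g0 : g ord0 = ores p (gfun a (@subset_refl _ U) (tX _ _) (inord 1)).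
  rewrite -tmapE -gres hg (@tXM_coef _ _ _ (inord 1) ord0) // inordK //.
  by rewrite ltnS (ltn_trans _ hn).
rewrite hg exprMn mulrCA tXn_mul tcoef0M gfun_coef0 // tCE /= rmorphXn /= -g0.
congr (tC _ _ * _); rewrite mulrC; congr (_ * _).
by rewrite tcoef0X.
Qed.

End Iota.

Lemma iota_res n (hn : (1 < n)%N) (U V : opens X) (p : V `<=` U) D :
  iotaT hn (tres p D) = gres p (iotaT hn D).
Proof. by apply: gautP. Qed.

Section Twist.
Variables (n : nat) (hn : (1 < n)%N).

(* D' = h . D, where h acts on T_X = ker tau through conjugation by any of    *)
(* its local liftings by tau; as X is smooth, h can be lifted locally.        *)
Definition hact (U : opens X) (h : hpair n U) (D D' : tsec U) : Prop :=
  forall (V : opens X) (p : V `<=` U) (a : gaut n.+1 V), tau a = hres p h ->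
    iotaT hn (tres p D') = (a * iotaT hn (tres p D) * a^-1)%g.

Lemma hact_scale (U : opens X) (h : hpair n U) D D' :
  hact h D D' <->
  forall (V : opens X) (p : V `<=` U) (a : gaut n.+1 V), tau a = hres p h ->
    tres p D' = gfun a (@subset_refl _ V) (tX _ _) (inord 1) ^+ n *: tres p D.
Proof.
split=> H V p a ha; first by have := H V p a ha; rewrite iota_conj => /iota_inj.
by rewrite iota_conj -(H V p a ha).
Qed.

Variables (I : Type) (U_ : I -> opens X).
Variable h : forall i j, hpair n (capo (U_ i) (U_ j)).

(* The sections over W of the sheaf obtained by gluing the T_X|U_i by means   *)
(* of the h i j are the families such that D_i = h_ij . D_j on W and U_ij.    *)
Record twsec (W : opens X) := TWSec {
  twfun : forall i, tsec (capo W (U_ i));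
  twP : forall i j (V : opens X) (pi : V `<=` capo W (U_ i))
      (pj : V `<=` capo W (U_ j)) (pij : V `<=` capo (U_ i) (U_ j)),
    hact (hres pij (h i j)) (tres pj (twfun j)) (tres pi (twfun i)) }.

Arguments twP {W} s {i j V} pi pj pij : rename.

Section Lmod.
Variable W : opens X.

Lemma twsecP (s s' : twsec W) : (forall i, twfun s i = twfun s' i) -> s = s'.
Proof.
case: s s' => [f a] [f' a'] /= H.
have ff : f = f' by apply: functional_extensionality_dep.
by subst; f_equal; apply: Prop_irrelevance.
Qed.

HB.instance Definition _ := gen_eqMixin (twsec W).
HB.instance Definition _ := gen_choiceMixin (twsec W).

Fact tres0 (U V : opens X) (p : V `<=` U) : tres p 0 = 0.
Proof. by apply: tsecP. Qed.
Fact tresN (U V : opens X) (p : V `<=` U) D : tres p (- D) = - tres p D.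
Proof. by apply: tsecP. Qed.

Program Definition twzero : twsec W := @TWSec W (fun i => 0) _.
Next Obligation.
move=> i j V pi pj pij; apply/hact_scale => V' p a _.
by rewrite !tres0 scaler0.
Qed.

Program Definition twopp (s : twsec W) : twsec W :=
  @TWSec W (fun i => - twfun s i) _.
Next Obligation.
move=> s i j V pi pj pij; apply/hact_scale => V' p a ha.
have /hact_scale/(_ _ _ _ ha) E := twP s pi pj pij.
by rewrite !tresN E scalerN.
Qed.

Program Definition twadd (s s' : twsec W) : twsec W :=
  @TWSec W (fun i => twfun s i + twfun s' i) _.
Next Obligation.
move=> s s' i j V pi pj pij; apply/hact_scale => V' p a ha.
have /hact_scale/(_ _ _ _ ha) E := twP s pi pj pij.
have /hact_scale/(_ _ _ _ ha) E' := twP s' pi pj pij.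
by rewrite !tresD E E' scalerDr.
Qed.

Program Definition twscale (a : ofun W) (s : twsec W) : twsec W :=
  @TWSec W (fun i => ores (@subIsetl _ _ _ : capo W (U_ i) `<=` W) a *: twfun s i) _.
Next Obligation.
move=> c s i j V pi pj pij; apply/hact_scale => V' p a ha.
have /hact_scale/(_ _ _ _ ha) E := twP s pi pj pij.
have q : V' `<=` W by move=> x V'x; have [] := pi _ (p _ V'x).
rewrite !tresZ E !scalerA mulrC; congr (_ * _ *: _).
by rewrite !(ores_comp _ _ (subset_trans p pi)) !(ores_comp _ _ (subset_trans p pj)) !(ores_comp _ _ q).
Qed.

Fact twaddA : associative twadd.
Proof. by move=> s s' s''; apply: twsecP => i /=; rewrite addrA. Qed.
Fact twaddC : commutative twadd.
Proof. by move=> s s'; apply: twsecP => i /=; rewrite addrC. Qed.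
Fact twadd0 : left_id twzero twadd.
Proof. by move=> s; apply: twsecP => i /=; rewrite add0r. Qed.
Fact twaddN : left_inverse twzero twopp twadd.
Proof. by move=> s; apply: twsecP => i /=; rewrite addNr. Qed.
HB.instance Definition _ := GRing.isZmodule.Build (twsec W) twaddA twaddC twadd0 twaddN.

Fact twscaleA a b s : twscale a (twscale b s) = twscale (a * b) s.
Proof. by apply: twsecP => i /=; rewrite rmorphM scalerA. Qed.
Fact twscale1 : left_id 1 twscale.
Proof. by move=> s; apply: twsecP => i /=; rewrite rmorph1 scale1r. Qed.
Fact twscaleDr : right_distributive twscale +%R.
Proof. by move=> a s s'; apply: twsecP => i /=; rewrite scalerDr. Qed.
Fact twscaleDl s : {morph twscale^~ s : a b / a + b}.
Proof. by move=> a b; apply: twsecP => i /=; rewrite rmorphD scalerDl. Qed.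
HB.instance Definition _ :=
  GRing.Zmodule_isLmodule.Build (ofun W) (twsec W) twscaleA twscale1 twscaleDr twscaleDl.

End Lmod.

Lemma capoS (W V U : opens X) : V `<=` W -> capo V U `<=` capo W U.
Proof. by move=> p x [Vx Ux]; split => //; apply: p. Qed.

Program Definition twres (W V : opens X) (p : V `<=` W) (s : twsec W) : twsec V :=
  @TWSec V (fun i => tres (@capoS _ _ (U_ i) p) (twfun s i)) _.
Next Obligation.
move=> W V p s i j V' pi pj pij.
rewrite (tres_comp _ _ (subset_trans pi (@capoS _ _ (U_ i) p))).
rewrite (tres_comp _ _ (subset_trans pj (@capoS _ _ (U_ j) p))).
exact: twP.
Qed.

Fact twresD (U V : opens X) (p : V `<=` U) : {morph twres p : s s' / s + s'}.
Proof. by move=> s s'; apply: twsecP => i; apply: tresD. Qed.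
Fact twresZ (U V : opens X) (p : V `<=` U) a s :
  twres p (a *: s) = ores p a *: twres p s.
Proof.
apply: twsecP => i /=; rewrite tresZ; congr (_ *: _).
have q : capo V (U_ i) `<=` U by move=> x [Vx _]; apply: p.
by rewrite !(ores_comp _ _ q).
Qed.
Fact twres_id (U : opens X) (p : U `<=` U) s : twres p s = s.
Proof. by apply: twsecP => i; apply: tres_id. Qed.
Fact twres_comp (U V W : opens X) (p : V `<=` U) (q : W `<=` V) (r : W `<=` U) s :
  twres q (twres p s) = twres r s.
Proof. by apply: twsecP => i; apply: tres_comp. Qed.

Fact twres_sep (U : opens X) (J : Type) (W : J -> opens X)
    (p : forall i, W i `<=` U) (s s' : twsec U) :
  oset U `<=` \bigcup_i oset (W i) ->
  (forall i, twres (p i) s = twres (p i) s') -> s = s'.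
Proof.
move=> cov H; apply: twsecP => i.
have pW k : capo (W k) (U_ i) `<=` capo U (U_ i) by apply: capoS.
apply: (tres_sep (p := pW)) => [x [Ux Uix]|k].
  by have [k _ Wx] := cov _ Ux; exists k.
have /(congr1 (fun s => twfun s i)) := H k.
by rewrite /= (Prop_irrelevance (pW k) (@capoS _ _ (U_ i) (p k))).
Qed.

Fact twres_glue (U : opens X) (J : Type) (W : J -> opens X)
    (p : forall i, W i `<=` U) (s : forall i, twsec (W i)) :
  oset U `<=` \bigcup_i oset (W i) ->
  (forall i j (V : opens X) (pi : V `<=` W i) (pj : V `<=` W j),
     twres pi (s i) = twres pj (s j)) ->
  exists s' : twsec U, forall i, twres (p i) s' = s i.
Proof.
move=> cov H.
have pW i k : capo (W k) (U_ i) `<=` capo U (U_ i) by apply: capoS; apply: p.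
have ex i : exists D : tsec (capo U (U_ i)), forall k,
    tres (pW i k) D = twfun (s k) i.
  apply: tres_glue => [x [Ux Uix]|k l V pk pl].
    by have [k _ Wx] := cov _ Ux; exists k.
  have qk : V `<=` W k by move=> x Vx; have [] := pk _ Vx.
  have ql : V `<=` W l by move=> x Vx; have [] := pl _ Vx.
  have Vi : V `<=` capo V (U_ i) by move=> x Vx; split=> //; have [] := pl _ Vx.
  have /(congr1 (fun s => tres Vi (twfun s i))) := H k l V qk ql.
  by rewrite /= !(tres_comp _ _ pk) !(tres_comp _ _ pl).
pose D i := projT1 (cid (ex i)).
have DE i k : tres (pW i k) (D i) = twfun (s k) i := projT2 (cid (ex i)) k.
have DP i j (V : opens X) (pi : V `<=` capo U (U_ i)) (pj : V `<=` capo U (U_ j))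
    (pij : V `<=` capo (U_ i) (U_ j)) :
    hact (hres pij (h i j)) (tres pj (D j)) (tres pi (D i)).
  apply/hact_scale => V' q a ha.
  have VW k : capo V' (W k) `<=` V' by apply: subIsetl.
  apply: (tres_sep (p := VW)) => [x V'x|k].
    by have [Ux _] := pi _ (q _ V'x); have [k _ Wx] := cov _ Ux; exists k.
  have qi : capo V' (W k) `<=` capo (W k) (U_ i).
    by move=> x [V'x Wx]; split => //; have [] := pi _ (q _ V'x).
  have qj : capo V' (W k) `<=` capo (W k) (U_ j).
    by move=> x [V'x Wx]; split => //; have [] := pj _ (q _ V'x).
  have qij : capo V' (W k) `<=` capo (U_ i) (U_ j).
    by move=> x [V'x Wx]; exact: (pij _ (q _ V'x)).
  have := twP (s k) qi qj qij.
  move=> /hact_scale /(_ _ (@subset_refl _ _) (gres (VW k) a)).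
  rewrite -!DE => E; rewrite tresZ.
  have {}E := E _; rewrite tau_res ha (hres_comp q (VW k) (subset_trans (VW k) q)) (hres_comp pij _ qij) (hres_comp qij _ qij) in E.
  have {E} := E erefl; rewrite !tres_id (tres_comp pi q (subset_trans q pi)).
  rewrite (tres_comp pj q (subset_trans q pj)).
  rewrite !(tres_comp _ _ (subset_trans (VW k) (subset_trans q pi))).
  rewrite !(tres_comp _ _ (subset_trans (VW k) (subset_trans q pj))).
  move=> ->; congr (_ *: _); rewrite !rmorphXn /=; congr (_ ^+ _).
  rewrite -tmapE.
  by rewrite -(@gfun_res _ _ a _ _ _ (subset_trans (@subset_refl _ _) (VW k))) tmapX.
exists (TWSec DP) => k; apply: twsecP => i /=.
by rewrite -DE; congr (tres _ _); apply: Prop_irrelevance.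
Qed.

(* T_X^g, for the class g of the cocycle h *)
Definition TXtw : omod :=
  @OMod twsec twres twresD twresZ twres_id twres_comp twres_sep twres_glue.

End Twist.

Section Cocycle.
Variables (n : nat) (I : Type) (U_ : I -> opens X).

Definition is_cocycle (h : forall i j, hpair n (capo (U_ i) (U_ j))) : Prop :=
  forall i j k (V : opens X) (pij : V `<=` capo (U_ i) (U_ j))
    (pjk : V `<=` capo (U_ j) (U_ k)) (pik : V `<=` capo (U_ i) (U_ k)),
    (hres pij (h i j) * hres pjk (h j k))%g = hres pik (h i k).

Variable phi : forall i j, gaut n (capo (U_ i) (U_ j)).

(* Sections over W of the structure sheaf of the scheme Y obtained by gluing  *)
(* the U_i x Spec C[t]/(t^n) along phi; Y has the same topological space as X *)
Record ysec (W : opens X) := YSec {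
  yfun : forall i, tpoly n (ofun (capo W (U_ i)));
  yP : forall i j (V : opens X) (pi : V `<=` capo W (U_ i))
      (pj : V `<=` capo W (U_ j)) (pij : V `<=` capo (U_ i) (U_ j)),
    tmap (ores pi) (yfun i) = gfun (phi i j) pij (tmap (ores pj) (yfun j)) }.

Section Ring.
Variable W : opens X.

Lemma ysecP (s s' : ysec W) : (forall i, yfun s i = yfun s' i) -> s = s'.
Proof.
case: s s' => [f a] [f' a'] /= H.
have ff : f = f' by apply: functional_extensionality_dep.
by subst; f_equal; apply: Prop_irrelevance.
Qed.

HB.instance Definition _ := gen_eqMixin (ysec W).
HB.instance Definition _ := gen_choiceMixin (ysec W).

Program Definition yzero : ysec W := @YSec W (fun i => 0) _.
Next Obligation. by move=> i j V pi pj pij; rewrite !rmorph0 gfun0. Qed.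

Program Definition yone : ysec W := @YSec W (fun i => 1) _.
Next Obligation. by move=> i j V pi pj pij; rewrite !rmorph1 gfun1. Qed.

Program Definition yopp (s : ysec W) : ysec W := @YSec W (fun i => - yfun s i) _.
Next Obligation.
move=> s i j V pi pj pij; rewrite !rmorphN /= (yP s pi pj pij).
by rewrite -[in RHS]sub0r gfun_zmod gfun0 sub0r.
Qed.

Program Definition yadd (s s' : ysec W) : ysec W :=
  @YSec W (fun i => yfun s i + yfun s' i) _.
Next Obligation.
move=> s s' i j V pi pj pij; rewrite !rmorphD /= (yP s pi pj pij).
by rewrite (yP s' pi pj pij) gfunD.
Qed.

Program Definition ymul (s s' : ysec W) : ysec W :=
  @YSec W (fun i => yfun s i * yfun s' i) _.
Next Obligation.
move=> s s' i j V pi pj pij; rewrite !rmorphM /= (yP s pi pj pij).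
by rewrite (yP s' pi pj pij) gfunM.
Qed.

Fact yaddA : associative yadd.
Proof. by move=> s s' s''; apply: ysecP => i /=; rewrite addrA. Qed.
Fact yaddC : commutative yadd.
Proof. by move=> s s'; apply: ysecP => i /=; rewrite addrC. Qed.
Fact yadd0 : left_id yzero yadd.
Proof. by move=> s; apply: ysecP => i /=; rewrite add0r. Qed.
Fact yaddN : left_inverse yzero yopp yadd.
Proof. by move=> s; apply: ysecP => i /=; rewrite addNr. Qed.
HB.instance Definition _ := GRing.isZmodule.Build (ysec W) yaddA yaddC yadd0 yaddN.

Fact ymulA : associative ymul.
Proof. by move=> s s' s''; apply: ysecP => i /=; rewrite mulrA. Qed.
Fact ymulC : commutative ymul.
Proof. by move=> s s'; apply: ysecP => i /=; rewrite mulrC. Qed.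
Fact ymul1 : left_id yone ymul.
Proof. by move=> s; apply: ysecP => i /=; rewrite mul1r. Qed.
Fact ymulDl : left_distributive ymul +%R.
Proof. by move=> s s' s''; apply: ysecP => i /=; rewrite mulrDl. Qed.
HB.instance Definition _ :=
  GRing.Zmodule_isComPzRing.Build (ysec W) ymulA ymulC ymul1 ymulDl.

End Ring.

Program Definition yres (W V : opens X) (p : V `<=` W) (s : ysec W) : ysec V :=
  @YSec V (fun i => tmap (ores (@capoS _ _ (U_ i) p)) (yfun s i)) _.
Next Obligation.
move=> W V p s i j V' pi pj pij.
have tmap_comp (A B C : opens X) (u : B `<=` A) (v : C `<=` B) (w : C `<=` A)
    (f : tpoly n (ofun A)) : tmap (ores v) (tmap (ores u) f) = tmap (ores w) f.
  by apply: tpolyP => k; rewrite !tmapE /= (ores_comp _ _ w).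
rewrite !(tmap_comp _ _ _ _ _ (subset_trans pi (@capoS _ _ (U_ i) p))).
rewrite !(tmap_comp _ _ _ _ _ (subset_trans pj (@capoS _ _ (U_ j) p))).
exact: yP.
Qed.

(* s restricts to a on the closed subscheme X of Y *)
Definition yred (W : opens X) (s : ysec W) (a : ofun W) : Prop :=
  forall i, in_t (yfun s i - tC n (ores (@subIsetl _ _ _ : capo W (U_ i) `<=` W) a)).

(* the ideal sheaf I_X of X in Y, and its square *)
Definition in_IX (W : opens X) (s : ysec W) : Prop := yred s 0.

Definition in_IX2 (W : opens X) (s : ysec W) : Prop :=
  forall x, oset W x -> exists (V : opens X) (p : V `<=` W), oset V x /\
    exists r (a b : 'I_r -> ysec V),
      (forall k, in_IX (a k) /\ in_IX (b k)) /\ yres p s = \sum_(k < r) a k * b k.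

(* pi exhibits the sheaf of O_X-modules L as the quotient I_X/I_X^2; its      *)
(* values outside I_X are irrelevant.                                         *)
Record is_conormal_map (L : omod) (pi : forall W, ysec W -> osec L W) : Prop := {
  cnD : forall W (s s' : ysec W), in_IX s -> in_IX s' ->
    pi W (s + s') = pi W s + pi W s';
  cnZ : forall W (f s : ysec W) a, yred f a -> in_IX s ->
    pi W (f * s) = a *: pi W s;
  cn_res : forall (W V : opens X) (p : V `<=` W) s, in_IX s ->
    pi V (yres p s) = mres p (pi W s);
  cn_surj : forall W (l : osec L W) x, oset W x ->
    exists (V : opens X) (p : V `<=` W), oset V x /\
      exists2 s, in_IX s & pi V s = mres p l;
  cn_ker : forall W (s : ysec W), in_IX s -> (pi W s = 0 <-> in_IX2 s) }.

Definition is_conormal (L : omod) : Prop :=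
  exists pi : forall W, ysec W -> osec L W, is_conormal_map pi.

End Cocycle.

Section Tensor.

Record is_omor (M N : omod) (f : forall U, osec M U -> osec N U) : Prop := {
  omorD : forall U, {morph f U : s s' / s + s'};
  omorZ : forall U a s, f U (a *: s) = a *: f U s;
  omor_res : forall (U V : opens X) (p : V `<=` U) s,
    f V (mres p s) = mres p (f U s) }.

Definition oiso (M N : omod) : Prop :=
  exists2 f : forall U, osec M U -> osec N U, is_omor f & forall U, bijective (f U).

Record is_bilinear (M N P : omod) (b : forall U, osec M U -> osec N U -> osec P U) :
    Prop := {
  bilDl : forall U s s' t, b U (s + s') t = b U s t + b U s' t;
  bilDr : forall U s t t', b U s (t + t') = b U s t + b U s t';
  bilZl : forall U a s t, b U (a *: s) t = a *: b U s t;
  bilZr : forall U a s t, b U s (a *: t) = a *: b U s t;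
  bil_res : forall (U V : opens X) (p : V `<=` U) s t,
    b V (mres p s) (mres p t) = mres p (b U s t) }.

(* P is (isomorphic to) the tensor product of the O_X-modules M and N: some   *)
(* bilinear morphism M x N -> P is universal.                                 *)
Definition is_tensor (M N P : omod) : Prop :=
  exists2 b : forall U, osec M U -> osec N U -> osec P U, is_bilinear b &
    forall (Q : omod) (c : forall U, osec M U -> osec N U -> osec Q U),
      is_bilinear c ->
      exists f : forall U, osec P U -> osec Q U,
        [/\ is_omor f, forall U s t, f U (b U s t) = c U s t
          & forall f', is_omor f' -> (forall U s t, f' U (b U s t) = c U s t) ->
              forall U s, f' U s = f U s].

Fixpoint is_tensor_power (L : omod) (k : nat) (P : omod) : Prop :=
  if k is k'.+1 then exists2 Q, is_tensor_power L k' Q & is_tensor L Q P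
  else oiso OX P.

End Tensor.

End Groups.

(* Main.v *)
(* The kernel of tau_n consists of the maps f + D(f) t^n with D a derivation,
   and phi conjugates D into c^n D, where phi(t) = ct + ... . That this
   describes the action of H_n requires local liftings along tau_n. On an
   affine chart, phi restricted to O_X is determined by the images of the
   coordinates; arbitrary liftings of these modulo t^(n+1) satisfy the
   equations of the chart up to an error in t^n, which is removed by inverting
   the Jacobian matrix. Hence T_X^g is glued from T_X by the n-th powers of the
   cocycle (c_ij). On Y, the class of t over U_i is a generator e_i of
   I_X/I_X^2, and e_j = c_ij e_i, so that (c_ij) is the cocycle of L. *)

Require Import Defs.
From HB Require Import structures.
From mathcomp Require Import all_boot all_algebra.
From mathcomp Require Import complex.
From mathcomp Require Import boolp classical_sets functions reals topology.
From mathcomp Require Import mpoly.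

Set Implicit Arguments.
Unset Strict Implicit.
Unset Printing Implicit Defensive.

Import GRing.Theory.
Local Open Scope classical_set_scope.
Local Open Scope ring_scope.

(** * The algebra A[t]/(t^m) *)

Section TpolyAlgebra.
Variables (A : comPzRingType).

(** The obstacle to lifting is that a [gaut] consists of maps on all smaller open sets V', whose
    regular functions need not be polynomials in the coordinates of a chart: such a function is a
    fraction P/Q only near each point. Lifted coordinates [w] are therefore extended point by point:
    the value at y of the lifting of f is P(w)/Q(w) in C[t]/(t^(n+1)), where Q(w) is a unit because
    its constant term is the nonzero number Q(c y). That this does not depend on the fraction is
    where [w] has to satisfy the equations of the chart exactly. As sections of O_X are functions,
    these values determine the lifting, and its algebraic properties are checked at points.

    Since [hact] quantifies over all local liftings, it would say nothing where there are none;
    their existence is what turns it into the equation D' = c^n D.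

    For part 2 no tensor product is constructed. The sheaves defined by the transition functions
    c_ij^k are shown to have the universal property, by a criterion in terms of local generators. *)

Fact tC_zmod m : zmod_morphism (@tC m A).
Proof. by move=> a b; rewrite tCD tCN. Qed.
Fact tC_monoid m : monoid_morphism (@tC m A).
Proof. by split=> // a b; rewrite tCM. Qed.
HB.instance Definition _ m :=
  GRing.isZmodMorphism.Build A (tpoly m A) (@tC m A) (@tC_zmod m).
HB.instance Definition _ m :=
  GRing.isMonoidMorphism.Build A (tpoly m A) (@tC m A) (@tC_monoid m).

Lemma tX_nilp m : tX m A ^+ m = 0.
Proof. by apply: tpolyP => k; rewrite tXn_coef t0E /= (ltn_eqF (ltn_ord k)). Qed.

Lemma tpoly_decomp m (f : tpoly m.+1 A) :
  exists g, f = tC m.+1 (f ord0) + tX m.+1 A * g.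
Proof.
have [g E] : in_t (f - tC m.+1 (f ord0)).
  apply: in_tP => k k0; rewrite taddE toppE tCE k0 eqxx.
  by rewrite (_ : k = ord0) ?subrr //; apply: val_inj.
by exists g; rewrite -E addrC subrK.
Qed.

Lemma tXnM_coef m k (f : tpoly m.+1 A) (j : 'I_m.+1) : val j = k ->
  (tX m.+1 A ^+ k * f) j = f ord0.
Proof.
move=> jk; have [g {1}->] := tpoly_decomp f.
rewrite mulrDr taddE mulrC tCM_coef tXn_coef jk eqxx mulr1 mulrA -exprSr.
rewrite tmulE big1 ?addr0 // => a _; rewrite big1 // => b /eqP E.
rewrite tXn_coef /= (_ : _ == _ = false) ?mul0r //; apply/ltn_eqF.
by rewrite ltnS -jk /= -E leq_addr.
Qed.

Lemma tpoly_sum m (f : tpoly m A) : f = \sum_(i < m) tC m (f i) * tX m A ^+ i.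
Proof.
apply: tpolyP => k; rewrite sum_ffunE (bigD1 k) //= big1 => [|i ik].
  by rewrite tCM_coef tXn_coef eqxx mulr1 addr0.
have ki : (val k == i) = false by apply/negbTE; rewrite eq_sym.
by rewrite tCM_coef tXn_coef ki mulr0.
Qed.

(** The element k = 1 - v f has constant term 0, hence is nilpotent, and 1 - k is inverted by the
    geometric series. *)
Lemma tpoly_inv m (f : tpoly m.+1 A) v : v * f ord0 = 1 -> exists g, g * f = 1.
Proof.
move=> vf; pose k := 1 - tC m.+1 v * f.
have [l kl] : in_t k.
  apply: in_tP => i i0; rewrite taddE toppE tCM_coef t1E tCE i0 eqxx.
  by rewrite (_ : i = ord0) ?vf ?subrr //; apply: val_inj.
have k0 : k ^+ m.+1 = 0 by rewrite kl exprMn tX_nilp mul0r.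
exists (tC m.+1 v * \sum_(i < m.+1) k ^+ i); rewrite mulrAC.
have -> : tC m.+1 v * f = 1 - k by rewrite /k opprB addrC subrK.
by rewrite -[LHS]opprK -mulNr opprB -subrX1 k0 sub0r opprK.
Qed.

End TpolyAlgebra.

(** * Bijectivity of endomorphisms that are triangular in t *)

Section Triangular.
Variables (A : comPzRingType) (m : nat) (E : tpoly m.+1 A -> tpoly m.+1 A).
Variables (u v : A) (g : tpoly m.+1 A).
Hypothesis EB : zmod_morphism E.
Hypothesis EM : monoid_morphism E.
Hypothesis E0 : forall f, E f ord0 = f ord0.
Hypothesis EX : E (tX _ A) = tX _ A * g.
Hypothesis g0 : g ord0 = u.
Hypothesis uv : u * v = 1.

HB.instance Definition _ :=
  GRing.isZmodMorphism.Build (tpoly m.+1 A) (tpoly m.+1 A) E EB.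
HB.instance Definition _ :=
  GRing.isMonoidMorphism.Build (tpoly m.+1 A) (tpoly m.+1 A) E EM.

Let EXnM k f : E (tX _ A ^+ k * f) = tX _ A ^+ k * (g ^+ k * E f).
Proof. by rewrite rmorphM rmorphXn /= EX exprMn mulrA. Qed.

Let coef0 k f : (g ^+ k * E f) ord0 = u ^+ k * f ord0.
Proof. by rewrite tcoef0M tcoef0X g0 E0. Qed.

Let vu k : v ^+ k * u ^+ k = 1.
Proof. by rewrite -exprMn mulrC uv expr1n. Qed.

(** [E] need not be A-linear, since it fixes constants only modulo t. It preserves the filtration by
    powers of t, however, and multiplies the leading coefficient of an element of (t^j) by the unit
    u^j, so that an element of the kernel lies in every (t^j). *)
Lemma triangular_inj : injective E.
Proof.
suff inj0 f : E f = 0 -> f = 0.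
  by move=> f f' ff'; apply/eqP; rewrite -subr_eq0; apply/eqP/inj0; rewrite rmorphB /= ff' subrr.
move=> Ef; suff [k ->] : exists k, f = tX _ A ^+ m.+1 * k by rewrite tX_nilp mul0r.
suff H j : (j <= m.+1)%N -> exists k, f = tX _ A ^+ j * k by exact: H.
elim: j => [_|j IH jm]; first by exists f; rewrite mul1r.
have [k fk] := IH (ltnW jm).
have : (tX _ A ^+ j * (g ^+ j * E k)) (Ordinal jm) = 0 by rewrite -EXnM -fk Ef t0E.
rewrite tXnM_coef // coef0 => /(congr1 ( *%R (v ^+ j))).
rewrite mulr0 mulrA vu mul1r => k0.
by have [l kl] := tpoly_decomp k; exists l; rewrite fk kl k0 rmorph0 add0r mulrA exprSr.
Qed.

Lemma triangular_surj y : exists f, E f = y.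
Proof.
suff H k : exists f r, E f - y = tX _ A ^+ k * r.
  have [f [r fr]] := H m.+1.
  by exists f; apply/eqP; rewrite -subr_eq0 fr tX_nilp mul0r.
elim: k => [|j [f [r IH]]]; first by exists 0, (E 0 - y); rewrite mul1r.
(* Subtracting t^j a from f subtracts u^j times the constant a from the leading coefficient of the
   error, whence the factor v^j. *)
pose a := tC m.+1 (v ^+ j * r ord0).
have [s sE] := tpoly_decomp (r - g ^+ j * E a).
exists (f - tX _ A ^+ j * a), s.
rewrite rmorphB /= EXnM addrAC IH -mulrBr sE.
rewrite taddE toppE coef0 tCE /= mulrA [u ^+ j * _]mulrC vu mul1r subrr.
by rewrite rmorph0 add0r mulrA exprSr.
Qed.

End Triangular.

(** * Substitution into truncated polynomials and into polynomials in several variables *)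

Section Subst.
Variables (A B : comPzRingType) (m : nat) (s : {rmorphism A -> B}) (T : B).
Hypothesis Tm : T ^+ m = 0.

Definition tsubst (f : tpoly m A) : B := \sum_(i < m) s (f i) * T ^+ i.

Lemma rmorph_tsubst (B' : comPzRingType) (f : {rmorphism B -> B'}) g :
  f (tsubst g) = \sum_(i < m) f (s (g i)) * f T ^+ i.
Proof. by rewrite rmorph_sum; apply: eq_bigr => i _; rewrite rmorphM rmorphXn. Qed.

Lemma tsubst_zmod : zmod_morphism tsubst.
Proof.
move=> f g; rewrite /tsubst -sumrB; apply: eq_bigr => i _.
by rewrite taddE toppE rmorphB mulrBl.
Qed.

(** The factor accounts for m = 0, when the sum is empty. *)
Lemma tsubstC a : tsubst (tC m a) = (0 < m)%:R * s a.
Proof.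
rewrite /tsubst; case: (posnP m) => [m0|m0].
  by rewrite mul0r big1 // => -[i im]; move: im; rewrite m0.
rewrite (bigD1 (Ordinal m0)) //= tCE eqxx mulr1 mul1r big1 ?addr0 // => i i0.
by rewrite tCE ifN ?rmorph0 ?mul0r.
Qed.

Lemma tsubstX : (1 < m)%N -> tsubst (tX m A) = T.
Proof.
move=> m1; rewrite /tsubst (bigD1 (Ordinal m1)) //= tXE rmorph1 mul1r expr1.
rewrite big1 ?addr0 // => i i1.
by rewrite tXE (_ : _ == _ = false) ?rmorph0 ?mul0r //; apply/negbTE.
Qed.

Lemma tsubstM : {morph tsubst : f g / f * g}.
Proof.
move=> f g; rewrite /tsubst mulr_suml.
under [RHS]eq_bigr do rewrite mulr_sumr.
transitivity (\sum_(k < m) \sum_(i < m) \sum_(j < m | (i + j == k)%N)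
    s (f i) * T ^+ i * (s (g j) * T ^+ j)).
  apply: eq_bigr => k _; rewrite tmulE rmorph_sum mulr_suml; apply: eq_bigr => i _.
  rewrite rmorph_sum mulr_suml; apply: eq_bigr => j /eqP <-.
  by rewrite rmorphM exprD mulrACA.
rewrite exchange_big /=; apply: eq_bigr => i _.
rewrite (exchange_big_dep predT) //=; apply: eq_bigr => j _.
have [lt|ge] := ltnP (i + j) m.
  by rewrite (eq_bigl (pred1 (Ordinal lt))) ?big_pred1_eq.
(* Products of degree at least m are absent from the left-hand side; on the right they vanish with
   T^m. *)
have Tij : T ^+ (i + j) = 0 by rewrite -(subnKC ge) exprD Tm mul0r.
rewrite mulrACA -exprD Tij mulr0.
rewrite big_pred0 // => k; apply/negP => /eqP E.
by move: (leq_trans (ltn_ord k) ge); rewrite -E ltnn.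
Qed.

End Subst.

Lemma tsubst_id (A : comPzRingType) m (f : tpoly m A) : tsubst (@tC m A) (tX m A) f = f.
Proof. by rewrite [RHS]tpoly_sum. Qed.

(* [mmap] requires a nonzero target ring, whereas the rings [ofun V] and      *)
(* [tpoly m A] may be zero.                                                   *)
Definition nzring (A : comPzRingType) (h : (1 : A) != 0) : Type := A.
HB.instance Definition _ (A : comPzRingType) (h : (1 : A) != 0) :=
  GRing.ComPzRing.on (nzring h).
HB.instance Definition _ (A : comPzRingType) (h : (1 : A) != 0) :=
  GRing.PzSemiRing_isNonZero.Build (nzring h) h.

Section Peval.
Variables (K : comNzRingType) (N : nat).

Lemma mpoly_ring_ind (P : {mpoly K[N]} -> Prop) :
  (forall c, P c%:MP_[N]) -> (forall i, P 'X_i) ->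
  (forall p q, P p -> P q -> P (p + q)) ->
  (forall p q, P p -> P q -> P (p * q)) -> forall p, P p.
Proof.
move=> PC PX PD PM; elim/mpolyind => [|c m p _ _ Pp]; first by rewrite -(mpolyC0 N K).
apply/PD => //; rewrite -mul_mpolyC; apply/PM => //.
rewrite mpolyXE_id; apply: (big_ind P); [by rewrite -(mpolyC1 N K) | exact: PM |].
move=> i _; elim: (m _) => [|k IH]; first by rewrite expr0 -(mpolyC1 N K).
by rewrite exprS; apply/PM.
Qed.

Section Def.
Variables (A : comPzRingType) (s : {rmorphism K -> A}) (w : 'I_N -> A).

Let nzs (h : (1 : A) != 0) : {rmorphism K -> nzring h} := s.

(** In the zero ring the default value 0 is the only element, so that this is a ring morphism in
    both cases. *)
Definition peval (p : {mpoly K[N]}) : A :=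
  match pselect ((1 : A) != 0) with
  | left h => @mmap N K (nzring h) (nzs h) w p
  | right _ => 0
  end.

Let zero_ring (a b : A) : ~ (1 : A) != 0 -> a = b.
Proof.
by move=> /negP; rewrite negbK => /eqP z; rewrite -[a]mulr1 -[b]mulr1 z !mulr0.
Qed.

Fact peval_zmod : zmod_morphism peval.
Proof.
rewrite /peval => p q; case: pselect => [h|h]; last exact: zero_ring.
exact: (rmorphB (@mmap N K (nzring h) (nzs h) w)).
Qed.
Fact peval_monoid : monoid_morphism peval.
Proof.
rewrite /peval; split=> [|p q]; case: pselect => [h|h]; try exact: zero_ring.
  exact: (rmorph1 (@mmap N K (nzring h) (nzs h) w)).
exact: (rmorphM (@mmap N K (nzring h) (nzs h) w)).
Qed.
HB.instance Definition _ :=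
  GRing.isZmodMorphism.Build {mpoly K[N]} A peval peval_zmod.
HB.instance Definition _ :=
  GRing.isMonoidMorphism.Build {mpoly K[N]} A peval peval_monoid.

Lemma pevalC c : peval c%:MP_[N] = s c.
Proof.
rewrite /peval; case: pselect => [h|h]; last exact: zero_ring.
exact: (@mmapC N K (nzring h) w (nzs h)).
Qed.

Lemma pevalX i : peval 'X_i = w i.
Proof.
rewrite /peval; case: pselect => [h|h]; last exact: zero_ring.
by rewrite (@mmapX N K (nzring h) w (nzs h)) mmap1U.
Qed.

Lemma peval_uniq (f : {rmorphism {mpoly K[N]} -> A}) :
  (forall c, f c%:MP_[N] = s c) -> (forall i, f 'X_i = w i) -> f =1 peval.
Proof.
move=> fC fX; elim/mpoly_ring_ind => [c|i|p q IHp IHq|p q IHp IHq].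
- by rewrite fC pevalC.
- by rewrite fX pevalX.
- by rewrite !rmorphD /= IHp IHq.
- by rewrite !rmorphM /= IHp IHq.
Qed.

End Def.

Lemma rmorph_peval (A B : comPzRingType) (s : {rmorphism K -> A}) (w : 'I_N -> A)
    (s' : {rmorphism K -> B}) (w' : 'I_N -> B) (f : {rmorphism A -> B}) :
  (forall c, f (s c) = s' c) -> (forall i, f (w i) = w' i) ->
  forall p, f (peval s w p) = peval s' w' p.
Proof.
move=> fs fw p; rewrite -[LHS]/((f \o peval s w) p).
by apply: peval_uniq => [c|i] /=; rewrite ?pevalC ?pevalX.
Qed.

Lemma peval_meval (v : 'I_N -> K) p : peval idfun v p = p.@[v].
Proof.
by apply/esym/(@peval_uniq K idfun v (meval v)) => [c|i] /=; rewrite ?mevalC ?mevalXU.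
Qed.

(** By induction on the ring operations: in a product the term in e * e vanishes and those in e
    combine by the Leibniz rule. It is applied to e = t^n. *)
Lemma peval_taylor (A : comPzRingType) (s : {rmorphism K -> A}) (w d : 'I_N -> A)
    (e : A) p : e * e = 0 ->
  peval s (fun k => w k + d k * e) p =
  peval s w p + (\sum_k d k * peval s w p^`M(k)) * e.
Proof.
move=> e0; elim/mpoly_ring_ind: p => [c|i|p q IHp IHq|p q IHp IHq].
- rewrite !pevalC big1 ?mul0r ?addr0 // => k _.
  by rewrite mderivC rmorph0 mulr0.
- rewrite !pevalX; congr (_ + _ * e); rewrite (bigD1 i) //= big1 => [|k ki].
    have E : (U_(i) - U_(i) = 0 :> 'X_{1.. N})%MM by apply/mnmP => k; rewrite mnmBE mnm0E subnn.
    by rewrite addr0 mderivX mnm1E eqxx scale1r E mpolyX0 rmorph1 mulr1.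
  rewrite mderivX mnm1E (_ : (i == k) = false) ?scale0r ?rmorph0 ?mulr0 //.
  by apply/negbTE; rewrite eq_sym.
- rewrite rmorphD /= IHp IHq rmorphD addrACA -mulrDl -big_split /=.
  congr (_ + _ * e); apply: eq_bigr => k _.
  by rewrite mderivD rmorphD mulrDr.
rewrite rmorphM /= IHp IHq rmorphM mulrDl !mulrDr -!addrA; congr (_ + _).
rewrite [X in _ + (_ + X)]mulrACA e0 mulr0 addr0 mulrA [X in _ + X]mulrAC -mulrDl.
congr (_ * e); rewrite mulr_sumr mulr_suml -big_split; apply: eq_bigr => k _ /=.
by rewrite mderivM rmorphD !rmorphM /= mulrDr addrC -mulrA [X in _ + X = _]mulrCA.
Qed.

End Peval.
#[global] Opaque peval.

(** * Values of sections at points, and affine charts *)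

Section Evaluation.
Variables (R : realType) (X : fspace R).
Local Notation C := R[i].

Section Ocst.
Variable U : opens X.
Fact ocst_zmod : zmod_morphism (ocst U). Proof. by move=> a b; apply: ofunP. Qed.
Fact ocst_monoid : monoid_morphism (ocst U).
Proof. by split=> [|a b]; apply: ofunP. Qed.
HB.instance Definition _ := GRing.isZmodMorphism.Build C (ofun U) (ocst U) ocst_zmod.
HB.instance Definition _ :=
  GRing.isMonoidMorphism.Build C (ofun U) (ocst U) ocst_monoid.

Definition oev (x : U) (f : ofun U) : C := f x.
Fact oev_zmod x : zmod_morphism (oev x). Proof. by []. Qed.
Fact oev_monoid x : monoid_morphism (oev x). Proof. by []. Qed.
HB.instance Definition _ x :=
  GRing.isZmodMorphism.Build (ofun U) C (oev x) (oev_zmod x).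
HB.instance Definition _ x :=
  GRing.isMonoidMorphism.Build (ofun U) C (oev x) (oev_monoid x).

(** Sections of O_X being functions, identities between truncated polynomials over them may be
    checked in C[t]/(t^m), one point at a time. *)
Lemma tev_inj m (f g : tpoly m (ofun U)) :
  (forall x, tmap (oev x) f = tmap (oev x) g) -> f = g.
Proof.
move=> H; apply: tpolyP => k; apply: ofunP => x.
by have := congr1 (fun h : tpoly m C => h k) (H x); rewrite !tmapE.
Qed.
End Ocst.

HB.instance Definition _ m (U V : opens X) (p : V `<=` U) (a : gaut m U) :=
  GRing.isZmodMorphism.Build (tpoly m (ofun V)) (tpoly m (ofun V)) (gfun a p)
    (gfun_zmod a p).
HB.instance Definition _ m (U V : opens X) (p : V `<=` U) (a : gaut m U) :=
  GRing.isMonoidMorphism.Build (tpoly m (ofun V)) (tpoly m (ofun V)) (gfun a p)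
    (gfun_monoid a p).

End Evaluation.

Section Coef0.
Variables (m : nat) (A : comPzRingType).
Definition tcoef0 (f : tpoly m.+1 A) : A := f ord0.
Fact tcoef0_zmod : zmod_morphism tcoef0.
Proof. by move=> f g; rewrite /tcoef0 taddE toppE. Qed.
Fact tcoef0_monoid : monoid_morphism tcoef0.
Proof.
split=> [|f g]; last exact: tcoef0M.
by rewrite /tcoef0 t1E tCE.
Qed.
HB.instance Definition _ :=
  GRing.isZmodMorphism.Build (tpoly m.+1 A) A tcoef0 tcoef0_zmod.
HB.instance Definition _ :=
  GRing.isMonoidMorphism.Build (tpoly m.+1 A) A tcoef0 tcoef0_monoid.
End Coef0.

Lemma ttr_tmap n (A B : comPzRingType) (s : {rmorphism A -> B}) (g : tpoly n.+1 A) :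
  ttr (tmap s g) = tmap s (ttr g).
Proof. by apply: tpolyP => k; rewrite ttrE !tmapE ttrE. Qed.

Section Chart.
Variables (R : realType) (X : fspace R).
Local Notation C := R[i].
Variables (U0 : opens X) (N : nat) (c : X -> 'I_N -> C).
Hypothesis ch : affine_chart U0 c.

(** The complement of W in the chart is cut out by a set of polynomials; one of them is nonzero at
    y, and where it is nonzero one is in W. *)
Lemma chart_basic (W : opens X) y : oset U0 y -> oset W y ->
  exists q : {mpoly C[N]}, q.@[c y] != 0 /\
    forall y', oset U0 y' -> q.@[c y'] != 0 -> oset W y'.
Proof.
case: ch => _ _ H _ Uy Wy.
have [_ [S ->] E] :=
  (H (oset U0 `&` oset W) (@subIsetl _ _ _)).1 (openI (oset_open U0) (oset_open W)).
have : (oset U0 `&` oset W) y by [].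
rewrite E => -[_ /= /existsNP [q /not_implyP [Sq /eqP qy]]].
exists q; split=> // y' Uy' qy'.
have : (oset U0 `&` oset W) y'; last by case.
by rewrite E; split=> //= /(_ q Sq) /eqP; apply/negP.
Qed.

Lemma chart_nz (q : {mpoly C[N]}) :
  exists V : opens X, oset V = [set y | oset U0 y /\ q.@[c y] != 0].
Proof.
case: ch => _ _ H _.
pose V := [set y | oset U0 y /\ q.@[c y] != 0].
have sV : V `<=` U0 by move=> y [].
have oV : open V.
  apply/(H _ sV); exists [set z | q.@[z] = 0].
    exists [set q]; apply/seteqP; split=> z /= => [qz _ -> //|]; exact.
  by apply/seteqP; split=> y [Uy /= /eqP qy]; split=> //; apply/eqP.
by exists (Opens oV).
Qed.

Lemma chart_frac (V : opens X) (p q : {mpoly C[N]}) : V `<=` U0 ->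
  (forall y, oset V y -> q.@[c y] != 0) ->
  exists f : ofun V, forall y : V, f y = p.@[c (val y)] / q.@[c (val y)].
Proof.
case: ch => _ _ _ H VU qV.
have rf : reg X V (fun y : V => p.@[c (val y)] / q.@[c (val y)]).
  apply/(H _ _ VU) => x; exists V, p, q; split; first exact: set_valP.
  by move=> y Vy; split=> //; apply: qV.
by exists (OFun (mem_set rf)).
Qed.

Lemma chart_local (V : opens X) (f : ofun V) (y : V) : V `<=` U0 ->
  exists (W : opens X) (p q : {mpoly C[N]}), oset W (val y) /\
    forall y' : V, oset W (val y') ->
      q.@[c (val y')] != 0 /\ f y' = p.@[c (val y')] / q.@[c (val y')].
Proof.
case: ch => _ _ _ H VU.
by have /(H _ _ VU)/(_ y) := set_mem (ovalP f).
Qed.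

Lemma chart_coord_ex (V : opens X) (VU : V `<=` U0) (k : 'I_N) :
  exists f : ofun V, forall y : V, f y = c (val y) k.
Proof.
have [|f fE] := @chart_frac V 'X_k 1 VU.
  by move=> y _; rewrite rmorph1 oner_neq0.
by exists f => y; rewrite fE rmorph1 divr1 mevalXU.
Qed.

Definition chart_coord (V : opens X) (VU : V `<=` U0) (k : 'I_N) : ofun V :=
  projT1 (cid (chart_coord_ex VU k)).

Lemma chart_coordE (V : opens X) (VU : V `<=` U0) k (y : V) :
  chart_coord VU k y = c (val y) k.
Proof. exact: projT2 (cid (chart_coord_ex VU k)) y. Qed.

Lemma chart_coord_res (V W : opens X) (VU : V `<=` U0) (WU : W `<=` U0) (p : W `<=` V) k :
  ores p (chart_coord VU k) = chart_coord WU k.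
Proof. by apply: ofunP => y; rewrite oresE !chart_coordE. Qed.

Lemma peval_coord (V : opens X) (VU : V `<=` U0) p (y : V) :
  peval (ocst V) (chart_coord VU) p y = p.@[c (val y)].
Proof.
rewrite -[LHS]/(oev y _) -peval_meval; apply: rmorph_peval => [//|k].
exact: chart_coordE.
Qed.

End Chart.

(** * Extending a lifting of the coordinates to all regular functions *)

Lemma cross_mul (A : comPzRingType) (a a' b b' q q' : A) :
  b * q = a -> b' * q' = a' -> a * q' = a' * q -> b * (q * q') = b' * (q * q').
Proof. by move=> E E' H; rewrite mulrA E H -E' -mulrA [q' * q]mulrC. Qed.

Lemma cross_sub (A : comPzRingType) (a a' b b' q q' : A) :
  b * q = a -> b' * q' = a' -> (b - b') * (q * q') = a * q' - a' * q.
Proof. by move=> <- <-; rewrite mulrBl mulrA -[b' * q' * q]mulrA [q' * q]mulrC. Qed.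

Lemma rmorph_eqM (A B : comPzRingType) (f : {rmorphism A -> B}) a b d :
  a * b = d -> f a * f b = f d.
Proof. by move=> <-; rewrite rmorphM. Qed.

Lemma mulI_inv (A : comPzRingType) (a b q g : A) : g * q = 1 -> a * q = b * q -> a = b.
Proof.
by move=> gq /(congr1 ( *%R^~ g)); rewrite -!mulrA [q * g]mulrC gq !mulr1.
Qed.

Section PolyLift.
Variables (R : realType) (X : fspace R).
Local Notation C := R[i].
Variables (U0 : opens X) (N : nat) (c : X -> 'I_N -> C).
Hypothesis ch : affine_chart U0 c.
Variables (r : nat) (F : 'I_r -> {mpoly C[N]}) (q0 : {mpoly C[N]}).
Hypothesis sat : forall p, vanishes (c @` oset U0) p ->
  exists k (a : 'I_r -> {mpoly C[N]}), q0 ^+ k * p = \sum_(l < r) a l * F l.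
Variables (V : opens X) (VU : V `<=` U0).
Hypothesis q0V : forall y, oset V y -> q0.@[c y] != 0.
Variables (m : nat) (w : 'I_N -> tpoly m.+1 (ofun V)).
Hypothesis w0 : forall k, w k ord0 = chart_coord ch VU k.
Hypothesis wF : forall l, peval (tC m.+1 \o ocst V) w (F l) = 0.

(** Substitution of the lifted coordinates at the single point y. The values lie in a local ring,
    where a polynomial that is nonzero at c y becomes a unit. *)
Definition ptpeval (y : V) : {mpoly C[N]} -> tpoly m.+1 C :=
  peval (@tC m.+1 C) (fun k => tmap (oev y) (w k)).
HB.instance Definition _ y := GRing.RMorphism.on (ptpeval y).

Lemma ptpevalB y : {morph ptpeval y : P Q / P - Q}. Proof. exact: rmorphB. Qed.
Lemma ptpevalM y : {morph ptpeval y : P Q / P * Q}. Proof. exact: rmorphM. Qed.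

Lemma tmap_peval (V' : opens X) (p : V' `<=` V) (y : V') P :
  tmap (oev y) (peval (tC m.+1 \o ocst V') (fun k => tmap (ores p) (w k)) P) =
  ptpeval (sincl p y) P.
Proof.
apply: rmorph_peval => [a|k] /=; first by rewrite tmapC.
by apply: tpolyP => i; rewrite !tmapE.
Qed.

Lemma ptpeval_coef0 y P : ptpeval y P ord0 = P.@[c (val y)].
Proof.
rewrite -[LHS]/(tcoef0 _) -peval_meval; apply: rmorph_peval => [a|k].
  by rewrite /= /tcoef0 tCE.
rewrite /= /tcoef0 tmapE w0; exact: chart_coordE.
Qed.

Lemma ptpeval_inv y P : P.@[c (val y)] != 0 -> exists g, g * ptpeval y P = 1.
Proof.
by move=> Py; apply: (@tpoly_inv _ _ _ (P.@[c (val y)])^-1); rewrite ptpeval_coef0 mulVf.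
Qed.

Lemma ptpevalI y P : P.@[c (val y)] != 0 -> injective ( *%R^~ (ptpeval y P)).
Proof.
move=> /ptpeval_inv [g gP] a b /= /(congr1 ( *%R^~ g)).
by rewrite -!mulrA [_ * g]mulrC gP !mulr1.
Qed.

(* A multiple [s * P], with [s] nonzero at [y], vanishes on the whole chart,  *)
(* hence lies in the ideal of the [F l] up to a power of [q0].                *)
Lemma ptpeval_vanish (W : opens X) (y : V) P : oset W (val y) ->
  (forall y', oset U0 y' -> oset W y' -> P.@[c y'] = 0) -> ptpeval y P = 0.
Proof.
move=> Wy PW; have Vy := set_valP y.
have [s [sy sW]] := chart_basic ch (VU Vy) Wy.
have [|k [a E]] := sat (p := s * P).
  move=> _ [y' Uy' <-]; rewrite rmorphM /=.
  have [->|sy'] := eqVneq s.@[c y'] 0; first by rewrite mul0r.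
  by rewrite PW ?mulr0 //; apply: sW.
have qs : (q0 ^+ k * s).@[c (val y)] != 0.
  by rewrite rmorphM rmorphXn /= mulf_neq0 ?expf_neq0 ?q0V.
apply: (ptpevalI qs); rewrite mul0r -ptpevalM mulrC -mulrA E rmorph_sum big1 // => l _.
rewrite /= ptpevalM (_ : ptpeval y (F l) = 0) ?mulr0 //.
have := congr1 (tmap (oev y)) (wF l); rewrite rmorph0 => <-.
apply/esym/rmorph_peval => [b|i] //=; by rewrite tmapC.
Qed.

Section Sub.
Variables (V' : opens X) (p : V' `<=` V).
Implicit Types (f : ofun V') (y : V').

(** Meaning that b = P(w)/Q(w) at y for some fraction P/Q representing f near y. It is a relation
    because the fraction is not unique. *)
Definition prel f y (b : tpoly m.+1 C) := exists (W : opens X) P Q,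
  [/\ oset W (val y),
      forall y', oset W (val y') ->
        Q.@[c (val y')] != 0 /\ f y' * Q.@[c (val y')] = P.@[c (val y')]
    & b * ptpeval (sincl p y) Q = ptpeval (sincl p y) P].

(** For two fractions representing f near y, P Q' - P' Q vanishes on the chart near y, so
    [ptpeval_vanish] applies to it. *)
Lemma prel_uniq f y b b' : prel f y b -> prel f y b' -> b = b'.
Proof.
move=> [W [P [Q [Wy H E]]]] [W' [P' [Q' [Wy' H' E']]]].
have [Qy _] := H y Wy; have [Qy' _] := H' y Wy'.
have QQ : (Q * Q').@[c (val (sincl p y))] != 0 by rewrite rmorphM /= mulf_neq0.
suff PP : ptpeval (sincl p y) (P * Q' - P' * Q) = 0.
  apply: (ptpevalI QQ); move/eqP: PP; rewrite ptpevalB !ptpevalM subr_eq0 => /eqP PP.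
  by apply: cross_mul E E' PP.
apply: (@ptpeval_vanish (capo V' (capo W W'))); first by split=> //; exact: (set_valP y).
move=> y' _ [Vy' [Wy1 Wy2]]; have [_ e] := H (selt Vy') Wy1.
have [_ e'] := H' (selt Vy') Wy2.
by rewrite rmorphB !rmorphM /= -e -e' mulrAC subrr.
Qed.

Lemma prelB f g y a b : prel f y a -> prel g y b -> prel (f - g) y (a - b).
Proof.
move=> [W [P [Q [Wy H E]]]] [W' [P' [Q' [Wy' H' E']]]].
exists (capo W W'), (P * Q' - P' * Q), (Q * Q'); split; [by [] | move=> y' [Wy1 Wy2] |].
  have [Q1 e] := H _ Wy1; have [Q2 e'] := H' _ Wy2.
  split; first by rewrite rmorphM /= mulf_neq0.
  by rewrite rmorphB !rmorphM /=; apply: cross_sub.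
rewrite ptpevalB (ptpevalM _ Q) (ptpevalM _ P) (ptpevalM _ P').
exact: cross_sub E E'.
Qed.

Lemma prelM f g y a b : prel f y a -> prel g y b -> prel (f * g) y (a * b).
Proof.
move=> [W [P [Q [Wy H E]]]] [W' [P' [Q' [Wy' H' E']]]].
exists (capo W W'), (P * P'), (Q * Q'); split; [by [] | move=> y' [Wy1 Wy2] |].
  have [Q1 e] := H _ Wy1; have [Q2 e'] := H' _ Wy2.
  split; first by rewrite rmorphM /= mulf_neq0.
  by rewrite !rmorphM /= mulrACA e e'.
by rewrite (ptpevalM _ P) (ptpevalM _ Q) mulrACA E E'.
Qed.

Lemma prel_cst a y : prel (ocst V' a) y (tC m.+1 a).
Proof.
exists V', a%:MP, 1; split=> [|y' _|]; first exact: set_valP.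
  by rewrite rmorph1 oner_neq0 mulr1 mevalC.
by rewrite rmorph1 mulr1 /ptpeval pevalC.
Qed.

Lemma prel_coef0 f y b : prel f y b -> b ord0 = f y.
Proof.
move=> [W [P [Q [Wy H E]]]]; have [Qy e] := H y Wy.
apply: (mulIf Qy); rewrite e -(ptpeval_coef0 (sincl p y)) -(ptpeval_coef0 (sincl p y)).
by rewrite -tcoef0M E.
Qed.

(** One fraction P/Q serves for all points near y, and Q(w) is invertible over that neighbourhood
    because its constant term is the nowhere zero function Q. Thus the pointwise values have regular
    coefficients. *)
Lemma prel_local f y : exists (V'' : opens X) (s : V'' `<=` V'), oset V'' (val y) /\
  exists g : tpoly m.+1 (ofun V''), forall z : V'', prel f (sincl s z) (tmap (oev z) g).
Proof.
have [W [P [Q [Wy H]]]] := chart_local ch f y (subset_trans p VU).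
have s : capo V' W `<=` V' by apply: subIsetl.
exists (capo V' W), s; split; first by split=> //; exact: set_valP.
have Qz z : oset (capo V' W) z -> Q.@[c z] != 0.
  by move=> [V'z Wz]; have [] := H (selt V'z) Wz.
pose ev := peval (tC m.+1 \o ocst (capo V' W))
                 (fun k => tmap (ores (subset_trans s p)) (w k)).
have [v vE] := @chart_frac _ _ _ _ _ ch _ 1 Q (subset_trans s (subset_trans p VU)) Qz.
have [|g gQ] := @tpoly_inv _ _ (ev Q) v.
  apply: ofunP => z; rewrite -[LHS]/(oev z _) rmorphM /= -(tmapE (oev z)).
  rewrite tmap_peval ptpeval_coef0 /oev vE rmorph1 div1r mulVf //.
  by apply: Qz; exact: set_valP.
exists (g * ev P) => z; exists W, P, Q; split=> [|y' Wy'|].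
- by have [] := set_valP z.
- by have [Qy ->] := H y' Wy'; rewrite divfK.
have E : sincl p (sincl s z) = sincl (subset_trans s p) z by apply: val_inj.
by rewrite E -!tmap_peval -rmorphM mulrAC gQ mul1r.
Qed.

Lemma plift_ex f : exists g : tpoly m.+1 (ofun V'), forall y, prel f y (tmap (oev y) g).
Proof.
have ex y : {b | prel f y b}.
  apply/cid; have [V'' [s [Vy [g gP]]]] := prel_local f y.
  exists (tmap (oev (selt Vy)) g).
  by have := gP (selt Vy); rewrite (_ : sincl _ _ = y) //; apply: val_inj.
pose b y := projT1 (ex y); have bP y : prel f y (b y) := projT2 (ex y).
have rb k : reg X V' (fun y => b y k).
  apply: reg_glue => y; have [V'' [s [Vy [g gP]]]] := prel_local f y.
  exists V'', s; split=> //; rewrite (_ : _ \o _ = g k :> (V'' -> _)).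
    exact: set_mem (ovalP (g k)).
  by apply: funext => z /=; rewrite (prel_uniq (bP _) (gP z)) tmapE.
exists [ffun k => OFun (mem_set (rb k))] => y.
rewrite (_ : tmap _ _ = b y) //; apply: tpolyP => k.
by rewrite tmapE ffunE.
Qed.

Definition plift f : tpoly m.+1 (ofun V') := projT1 (cid (plift_ex f)).

Lemma pliftP f y : prel f y (tmap (oev y) (plift f)).
Proof. exact: projT2 (cid (plift_ex f)) y. Qed.

Lemma plift_uniq f g : (forall y, prel f y (tmap (oev y) g)) -> plift f = g.
Proof. by move=> H; apply: tev_inj => y; apply: prel_uniq (pliftP f y) (H y). Qed.

Fact plift_zmod : zmod_morphism plift.
Proof.
move=> f g; apply: plift_uniq => y; rewrite rmorphB.
by apply: prelB; apply: pliftP.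
Qed.
Fact plift_monoid : monoid_morphism plift.
Proof.
split=> [|f g]; apply: plift_uniq => y.
  have -> : 1 = ocst V' 1 :> ofun V' by apply: ofunP.
  by rewrite (rmorph1 (tmap (oev y))) t1E; apply: prel_cst.
by rewrite rmorphM; apply: prelM; apply: pliftP.
Qed.
HB.instance Definition _ :=
  GRing.isZmodMorphism.Build (ofun V') (tpoly m.+1 (ofun V')) plift plift_zmod.
HB.instance Definition _ :=
  GRing.isMonoidMorphism.Build (ofun V') (tpoly m.+1 (ofun V')) plift plift_monoid.

Lemma plift_cst a : plift (ocst V' a) = tC m.+1 (ocst V' a).
Proof. by apply: plift_uniq => y; rewrite tmapC; apply: prel_cst. Qed.

Lemma plift_coef0 f : plift f ord0 = f.
Proof.
by apply: ofunP => y; rewrite -[LHS]/(oev y _) -tmapE; apply: prel_coef0 (pliftP f y).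
Qed.

End Sub.

Lemma plift_res (V' V'' : opens X) (p : V' `<=` V) (q : V'' `<=` V)
    (s : V'' `<=` V') f : plift q (ores s f) = tmap (ores s) (plift p f).
Proof.
apply: plift_uniq => y; have [W [P [Q [Wy H E]]]] := pliftP p f (sincl s y).
have -> : tmap (oev y) (tmap (ores s) (plift p f)) = tmap (oev (sincl s y)) (plift p f).
  by apply: tpolyP => k; rewrite !tmapE.
have e : sincl p (sincl s y) = sincl q y by apply: val_inj.
exists W, P, Q; split; [exact: Wy | move=> y' Wy'; exact: H (sincl s y') Wy' |].
by rewrite -e; exact: E.
Qed.

(** Near a point f Q = P. The two morphisms agree on polynomials in the coordinates, hence on P and
    Q, and the image of Q at the point is a unit. *)
Lemma plift_ttr (a : gaut m V) :
  (forall k, ttr (w k) = gfun a (@subset_refl _ V) (tC m (chart_coord ch VU k))) ->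
  forall (V' : opens X) (p : V' `<=` V) f, ttr (plift p f) = gfun a p (tC m f).
Proof.
move=> wa V' p f; apply: tev_inj => y.
have [W [P [Q [Wy H E]]]] := pliftP p f y.
have s : capo V' W `<=` V' by apply: subIsetl.
have t := subset_trans s p.
have V''y : oset (capo V' W) (val y) by split=> //; exact: set_valP.
(* The fraction represents f on W only, so [a] is first restricted to the intersection of V' and
   W. *)
have EPQ : gfun a t (tC m (ores s f)) *
    gfun a t (tC m (peval (ocst _) (chart_coord ch (subset_trans t VU)) Q)) =
    gfun a t (tC m (peval (ocst _) (chart_coord ch (subset_trans t VU)) P)).
  rewrite -rmorphM -[_ * tC m _]rmorphM /=; congr (gfun _ _ (tC _ _)).
  apply: ofunP => z; rewrite peval_coord.
  have Wz : oset W (val (sincl s z)) by have [] := set_valP z.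
  apply: etrans (H _ Wz).2.
  exact: (congr1 ( *%R (f (sincl s z))) (peval_coord ch (subset_trans t VU) Q z)).
have phiE P' : tmap (oev (selt V''y))
    (gfun a t (tC m (peval (ocst _) (chart_coord ch (subset_trans t VU)) P'))) =
    ttr (ptpeval (sincl p y) P').
  pose g : {rmorphism _ -> _} :=
    tmap (oev (selt V''y)) \o (gfun a t \o @tC m (ofun (capo V' W))).
  pose h : {rmorphism _ -> _} := @ttr m C \o ptpeval (sincl p y).
  rewrite -[LHS]/(g _) -[RHS]/(h _).
  rewrite (rmorph_peval (s' := @tC m C) (w' := fun k => ttr (tmap (oev (sincl p y)) (w k)))).
  - apply/esym/peval_uniq => [b|k] /=; first by rewrite /ptpeval pevalC ttrC.
    by rewrite /ptpeval pevalX.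
  - by move=> b /=; rewrite gfun_cst tmapC.
  - move=> k /=; rewrite ttr_tmap wa.
    rewrite -(chart_coord_res ch VU (subset_trans t VU) t) -tmapC.
    rewrite (gfun_res a (@subset_refl _ V)).
    apply: tpolyP => i; rewrite !tmapE /oev /=; congr (oval _ _).
    exact: val_inj.
have {}EPQ : tmap (oev y) (gfun a p (tC m f)) * ttr (ptpeval (sincl p y) Q) =
    ttr (ptpeval (sincl p y) P).
  have <- : tmap (oev (selt V''y)) (gfun a t (tC m (ores s f))) =
      tmap (oev y) (gfun a p (tC m f)).
    rewrite -tmapC (gfun_res a p); apply: tpolyP => i; rewrite !tmapE /oev /=.
    by congr (oval _ _); apply: val_inj.
  apply: etrans (phiE P).
  apply: etrans (congr1 ( *%R _) (esym (phiE Q))) _.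
  exact (rmorph_eqM (tmap (oev (selt V''y))) EPQ).
have [g gQ] := @ptpeval_inv (sincl p y) Q (H y Wy).1.
rewrite -ttr_tmap; apply: (mulI_inv (q := ttr (ptpeval (sincl p y) Q)) (g := ttr g)).
- exact: etrans (rmorph_eqM (@ttr m C) gQ) (rmorph1 (@ttr m C)).
- exact: etrans (rmorph_eqM (@ttr m C) E) (esym EPQ).
Qed.

End PolyLift.

(** * Local liftings along tau_n at a smooth point *)

Section LocalLift.
Variables (R : realType) (X : fspace R).
Local Notation C := R[i].
Variables (n : nat) (n0 : (0 < n)%N).

Lemma tlift_coef0 (A : comPzRingType) (f : tpoly n A) : tlift f ord0 = f (Ordinal n0).
Proof. by rewrite ffunE /= insubT. Qed.

Lemma tXn_sqr (A : comPzRingType) : tX n.+1 A ^+ n * tX n.+1 A ^+ n = 0.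
Proof.
by rewrite -exprD -(subnKC (_ : n.+1 <= n + n)%N) ?exprD ?tX_nilp ?mul0r // -addn1 leq_add2l.
Qed.

(** With J the Jacobian matrix and M a constant right inverse of its value at z, take K = M adj(J M)
    and g = det(J M). The value of g at z is 1, and the identity holds between polynomials, hence
    also away from z. *)
Lemma jacobian_inverse N r (F : 'I_r -> {mpoly C[N]}) (z : 'I_N -> C) :
  row_free (\matrix_(l < r, k < N) ((F l)^`M(k)).@[z]) ->
  exists (K : 'M[{mpoly C[N]}]_(N, r)) (g : {mpoly C[N]}), g.@[z] != 0 /\
    forall l j, \sum_k (F l)^`M(k) * K k j = g *+ (l == j).
Proof.
move=> /row_freeP [M JM].
pose Jp : 'M[{mpoly C[N]}]_(r, N) := \matrix_(l < r, k < N) (F l)^`M(k).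
pose Mp := map_mx (@mpolyC N C) M.
exists (Mp *m \adj (Jp *m Mp)), (\det (Jp *m Mp)); split.
  rewrite -(det_map_mx (meval z)) map_mxM /=.
  rewrite (_ : map_mx _ Jp = \matrix_(l < r, k < N) ((F l)^`M(k)).@[z]); last first.
    by apply/matrixP => l k; rewrite !mxE.
  rewrite (_ : map_mx _ Mp = M) ?JM ?det1 ?oner_neq0 //.
  by apply/matrixP => l k; rewrite !mxE mevalC.
move=> l j; have := mul_mx_adj (Jp *m Mp).
rewrite -mulmxA => /matrixP /(_ l j); rewrite !mxE => <-.
by apply: eq_bigr => k _; rewrite !mxE.
Qed.

Lemma gfun_peval (U : opens X) (a : gaut n U) (V : opens X) (p : V `<=` U) N
    (z : 'I_N -> ofun V) P :
  gfun a p (tC n (peval (ocst V) z P)) =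
  peval (tC n \o ocst V) (fun k => gfun a p (tC n (z k))) P.
Proof.
pose g : {rmorphism _ -> _} := gfun a p \o @tC n (ofun V).
by rewrite -[LHS]/(g _); apply: rmorph_peval => [c|k] //=; rewrite gfun_cst.
Qed.

Lemma coef0_peval (V : opens X) N (w : 'I_N -> tpoly n.+1 (ofun V)) P :
  peval (tC n.+1 \o ocst V) w P ord0 = peval (ocst V) (fun k => w k ord0) P.
Proof.
rewrite -[LHS]/(tcoef0 _); apply: rmorph_peval => [c|k] //=.
by rewrite /tcoef0 tCE.
Qed.

(* Newton's step: the error [e] of an arbitrary lifting [w'] is corrected by  *)
(* inverting the Jacobian matrix.                                             *)
Lemma lift_coord (V : opens X) N r (F : 'I_r -> {mpoly C[N]})
    (K : 'M[{mpoly C[N]}]_(N, r)) (g : {mpoly C[N]}) (z : 'I_N -> ofun V) (gi : ofun V)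
    (wn : 'I_N -> tpoly n (ofun V)) :
  (forall l j, \sum_k (F l)^`M(k) * K k j = g *+ (l == j)) ->
  peval (ocst V) z g * gi = 1 ->
  (forall k, wn k (Ordinal n0) = z k) ->
  (forall l, peval (tC n \o ocst V) wn (F l) = 0) ->
  exists w : 'I_N -> tpoly n.+1 (ofun V),
    [/\ forall k, ttr (w k) = wn k, forall k, w k ord0 = z k
      & forall l, peval (tC n.+1 \o ocst V) w (F l) = 0].
Proof.
move=> JK ggi wn0 wnF; pose w' k := tlift (wn k).
have w'0 k : w' k ord0 = z k by rewrite tlift_coef0 wn0.
have pev0 P : peval (tC n.+1 \o ocst V) w' P ord0 = peval (ocst V) z P.
  by rewrite coef0_peval (_ : (fun k => w' k ord0) = z) //; apply: funext.
pose e l := peval (tC n.+1 \o ocst V) w' (F l) ord_max.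
have eE l : peval (tC n.+1 \o ocst V) w' (F l) = tC n.+1 (e l) * tX n.+1 _ ^+ n.
  apply: ttr_eq0; rewrite -(wnF l); apply: rmorph_peval => [c|k] /=; first exact: ttrC.
  exact: tliftK.
(* Adding d t^n to [w'] adds (J d) t^n to F(w'), whose value is e t^n. So J d = -e is required, and
   d = -K e / g solves it. Only the constant terms of J matter, being multiplied by t^n. *)
pose d k := - \sum_j peval (ocst V) z (K k j) * (e j * gi).
exists (fun k => w' k + tC n.+1 (d k) * tX n.+1 _ ^+ n); split=> [k|k|l].
- by rewrite rmorphD rmorphM rmorphXn /= ttrX tX_nilp mulr0 addr0 tliftK.
- by rewrite taddE tCM_coef tXn_coef w'0 (_ : (_ == _) = false) ?mulr0 ?addr0 // ltn_eqF.
rewrite peval_taylor ?tXn_sqr // eE -mulrDl mulrC tXn_mul taddE tCE /=.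
suff -> : (\sum_k tC n.+1 (d k) * peval (tC n.+1 \o ocst V) w' (F l)^`M(k)) ord0 = - e l.
  by rewrite subrr rmorph0 mul0r.
rewrite sum_ffunE.
under eq_bigr do rewrite tCM_coef pev0 /d mulNr mulr_suml.
rewrite sumrN exchange_big /=; congr (- _).
transitivity (\sum_j peval (ocst V) z (g *+ (l == j)) * (e j * gi)).
  apply: eq_bigr => j _; rewrite -JK rmorph_sum mulr_suml; apply: eq_bigr => k _.
  by rewrite [in RHS]rmorphM /= [LHS]mulrC [LHS]mulrA.
rewrite (bigD1 l) //= eqxx mulr1n big1 ?addr0 => [|j jl].
  by rewrite mulrCA ggi mulr1.
by rewrite (_ : (l == j) = false) ?mulr0n ?rmorph0 ?mul0r // eq_sym; apply/negbTE.
Qed.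

(** This lifts the restriction of [a] to O_X only; the image of t is lifted separately, in
    [hpair_lift]. *)
Lemma lift_structure (U : opens X) (a : gaut n U) x : oset U x -> smooth_at x ->
  exists (V : opens X) (p : V `<=` U), oset V x /\
  exists s : forall V' : opens X, V' `<=` V ->
      {rmorphism ofun V' -> tpoly n.+1 (ofun V')},
    [/\ forall (V' : opens X) (q : V' `<=` V) c,
          s V' q (ocst V' c) = tC n.+1 (ocst V' c),
        forall (V' W : opens X) (q : V' `<=` V) (q' : W `<=` V) (t : W `<=` V') f,
          s W q' (ores t f) = tmap (ores t) (s V' q f),
        forall (V' : opens X) (q : V' `<=` V) f, s V' q f ord0 = f
      & forall (V' : opens X) (q : V' `<=` V) f,
          ttr (s V' q f) = gfun (gres p a) q (tC n f)].
Proof.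
move=> Ux [U0 [N [c [ch U0x [r [F [q0 [FU q0x sat rf]]]]]]]].
have [K [g [gx JK]]] := jacobian_inverse rf.
(* Where [q0] is nonzero the [F l] generate the ideal of the chart, and where g is nonzero the
   Jacobian matrix has a right inverse. *)
have [V0 V0E] := chart_nz ch (q0 * g).
pose V := capo U V0.
have VU0 : V `<=` U0 by move=> y [_]; rewrite V0E => -[].
have nz y : oset V y -> q0.@[c y] != 0 /\ g.@[c y] != 0.
  by move=> [_]; rewrite V0E => -[_]; rewrite rmorphM mulf_eq0 => /norP.
have p : V `<=` U by apply: subIsetl.
exists V, p; split.
  by split=> //; rewrite V0E; split=> //; rewrite rmorphM mulf_neq0.
have [gi giE] := @chart_frac _ _ _ _ _ ch _ 1 g VU0 (fun y Vy => (nz y Vy).2).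
pose z := chart_coord ch VU0; pose id_V := @subset_refl _ (V : set X).
have [|k|l|w [w_ttr w_0 w_F]] := @lift_coord V N r F K g z gi
    (fun k => gfun (gres p a) id_V (tC n (z k))) JK.
- apply: ofunP => y; rewrite -[LHS]/(oev y _) rmorphM /= /oev giE rmorph1 div1r.
  by rewrite peval_coord divff ?(nz _ (set_valP y)).2.
- by rewrite gfun_coef0 // tCE.
- rewrite -gfun_peval (_ : peval _ _ _ = 0) ?rmorph0 //.
  apply: ofunP => y; rewrite peval_coord FU //; exists (val y) => //.
  exact: VU0 (set_valP y).
pose s := @plift R X U0 N c ch r F q0 sat V VU0 (fun y Vy => (nz y Vy).1) n w w_0 w_F.
exists (fun V' q => s V' q); split=> [V' q b|V' W q q' t f|V' q f|V' q f].
- exact: plift_cst.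
- exact: plift_res.
- exact: plift_coef0.
- exact: (plift_ttr _ _ _ w_F w_ttr q f).
Qed.

End LocalLift.

Lemma tmap_tlift n (A B : comPzRingType) (s : {rmorphism A -> B}) (f : tpoly n A) :
  tmap s (tlift f) = tlift (tmap s f).
Proof.
apply: tpolyP => i; rewrite tmapE !ffunE.
by case: insubP => [j _ _|_] /=; rewrite ?tmapE ?rmorph0.
Qed.

Section HpairLift.
Variables (R : realType) (X : fspace R) (m : nat).
Local Notation n := m.+2.

Lemma haut_tX (U V : opens X) (p : V `<=` U) (h : hpair n U) :
  gfun (haut h) p (tX n _) = tmap (ores p) (hu h) * tX n _.
Proof.
have := congr1 (tmap (ores p)) (haut_t h); rewrite rmorphM /= tmapX => <-.
by rewrite -(gfun_res (haut h) _ p) tmapX.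
Qed.

(** Write the preimage of t as t g and apply the automorphism: comparing the coefficients of t, a
    degree that exists because n is at least 2, gives u_0 g_0 = 1. *)
Lemma hu_unit (U : opens X) (h : hpair n U) : exists v, hu h ord0 * v = 1.
Proof.
have [g hg] : in_t (ginv (haut h) (@subset_refl _ (U : set X)) (tX n _)).
  by apply: (gfun_in_t (haut h)^-1%g); exists 1; rewrite mulr1.
exists (g ord0).
have := ginvK (haut h) (@subset_refl _ (U : set X)) (tX n _).
rewrite hg gfunM haut_t [_ * tX n _]mulrC -mulrA.
move=> /(congr1 (fun f : tpoly n _ => f (lift ord0 ord0))).
by rewrite (@tXM_coef _ _ _ _ ord0) // tcoef0M gfun_coef0 // tXE.
Qed.

(** The lifting acts on O_X by the morphisms [s] of [lift_structure] and sends t to t u, for an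
    arbitrary lifting of u. It is bijective by the triangular lemmas, the constant term of u being a
    unit. *)
Lemma hpair_lift (U : opens X) (h : hpair n U) x : oset U x -> smooth_at x ->
  exists (V : opens X) (p : V `<=` U), oset V x /\
    exists a : gaut n.+1 V, tau a = hres p h.
Proof.
move=> Ux sm.
have [V [p [Vx [s [s_cst s_res s_0 s_ttr]]]]] := lift_structure (ltn0Sn _) (haut h) Ux sm.
exists V, p; split=> //.
(* The coefficient 0 that [tlift] puts in degree n is arbitrary: in t u it would be moved to degree
   n + 1, so [tau] still recovers u modulo t^n. *)
pose u (V' : opens X) (q : V' `<=` V) := tlift (tmap (ores (subset_trans q p)) (hu h)).
pose T (V' : opens X) (q : V' `<=` V) := tX n.+1 (ofun V') * u V' q.
have T_nilp V' q : T V' q ^+ n.+1 = 0 by rewrite exprMn tX_nilp mul0r.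
pose E V' q := tsubst (s V' q) (T V' q) : tpoly n.+1 (ofun V') -> tpoly n.+1 (ofun V').
have EX V' q : E V' q (tX _ _) = tX _ _ * u V' q by rewrite /E tsubstX.
have EC V' q f : E V' q (tC _ f) = s V' q f by rewrite /E tsubstC mul1r.
have EM V' q : monoid_morphism (E V' q).
  by split; [rewrite t1E EC rmorph1 | apply: tsubstM; apply: T_nilp].
have EB V' q : zmod_morphism (E V' q) by apply: tsubst_zmod.
have E0 V' q f : E V' q f ord0 = f ord0.
  have T0 : T V' q ord0 = 0 by rewrite tXM_coef0.
  rewrite /E /tsubst big_ord_recl expr0 mulr1 taddE s_0 sum_ffunE big1 ?addr0 // => i _.
  by rewrite tcoef0M tcoef0X T0 expr0n mulr0.
have [v hv] := hu_unit h.
have u0 V' q : u V' q ord0 = ores (subset_trans q p) (hu h ord0).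
  have e0 : Ordinal (ltn0Sn m.+1) = ord0 by apply: val_inj.
  by rewrite /u (tlift_coef0 (ltn0Sn _)) e0 tmapE.
have uv (V' : opens X) (q : V' `<=` V) :
    ores (subset_trans q p) (hu h ord0) * ores (subset_trans q p) v = 1.
  by rewrite -rmorphM /= hv rmorph1.
have E_inj V' q := triangular_inj (EB V' q) (EM V' q) (E0 V' q) (EX V' q) (u0 V' q) (uv V' q).
have E_surj V' q := triangular_surj (EB V' q) (EM V' q) (E0 V' q) (EX V' q) (u0 V' q) (uv V' q).
pose G V' q f := projT1 (cid (E_surj V' q f)).
have GK V' q : cancel (G V' q) (E V' q) by move=> f; exact: projT2 (cid (E_surj V' q f)).
have EK V' q : cancel (E V' q) (G V' q) by move=> f; apply: E_inj; rewrite GK.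
have E_add V' q : {morph E V' q : f g / f + g}.
  by move=> f g; have := EB V' q (f + g) g; rewrite addrK => ->; rewrite subrK.
have E_sub V' q f k : val k = 0%N -> (E V' q f - f) k = 0.
  move=> k0; rewrite (_ : k = ord0); last exact: val_inj.
  by rewrite taddE toppE E0 subrr.
have T_res (V' W : opens X) (q : V' `<=` V) (q' : W `<=` V) (t : W `<=` V') :
    T W q' = tmap (ores t) (T V' q).
  rewrite /T (rmorphM (tmap (ores t))) /= tmapX /u tmap_tlift; congr (_ * tlift _).
  by apply: tpolyP => j; rewrite !tmapE /= (ores_comp _ _ (subset_trans q' p)).
have ttrT V' q : ttr (T V' q) = gfun (haut h) (subset_trans q p) (tX n _).
  by rewrite haut_tX /T /u (rmorphM (@ttr n _)) /= ttrX tliftK [RHS]mulrC.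
have E_res (V' W : opens X) (q : V' `<=` V) (q' : W `<=` V) (t : W `<=` V') f :
    E W q' (tmap (ores t) f) = tmap (ores t) (E V' q f).
  by rewrite (rmorph_tsubst _ _ (tmap (ores t))) /E /tsubst (T_res _ _ q q' t);
    apply: eq_bigr => i _; rewrite tmapE (s_res _ _ q).
pose a : gaut n.+1 V := @GAut R X n.+1 V E G EK GK E_add (fun V' q => (EM V' q).2)
  (fun V' q b => etrans (EC V' q _) (s_cst V' q b)) E_res
  (fun V' q f => in_tP (E_sub V' q f)).
exists a; apply: hpairP.
  apply: gautP => V' q f.
  rewrite -[RHS]/(gfun (haut h) (subset_trans q p) f).
  rewrite -[LHS]/(ttr (E V' q (tlift f))) (rmorph_tsubst _ _ (@ttr n _)).
  pose g : {rmorphism _ -> _} := gfun (haut h) (subset_trans q p) \o @ttr n _.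
  have -> : gfun (haut h) (subset_trans q p) f = g (tlift f) by rewrite /= tliftK.
  (* By [tsubst_id], [tlift f] is the sum of its terms f_i t^i, so it is enough to compare the
     images of the f_i and of t. *)
  rewrite (etrans (congr1 g (esym (tsubst_id (tlift f)))) (rmorph_tsubst _ _ g _)).
  apply: eq_bigr => i _; by rewrite /= s_ttr ttrC ttrX ttrT.
apply: tpolyP => k; rewrite ffunE -[gfun a _ _]/(E V _ _) EX.
rewrite (@tXM_coef _ _ _ _ (widen_ord (leqnSn _) k)) // -ttrE tliftK !tmapE /=.
by congr (ores _ _); apply: Prop_irrelevance.
Qed.

End HpairLift.

(** * The action of H_n on T_X, and the kernel of tau_n *)

Lemma sqr0_mul (A : comPzRingType) (f g a b e : A) : e * e = 0 ->
  (f + a * e) * (g + b * e) = f * g + (f * b + a * g) * e.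
Proof.
move=> e0; rewrite mulrDl !mulrDr -!addrA mulrDl [a * e * (b * e)]mulrACA e0 mulr0 addr0.
by rewrite mulrA [a * e * g]mulrAC.
Qed.

Section Hact.
Variables (R : realType) (X : fspace R) (m : nat).
Local Notation n := m.+2.
Variable hn : (1 < n)%N.

(** From right to left this is the conjugation formula for each lifting. From left to right, local
    liftings exist near every point, and derivations that agree on a cover are equal. *)
Lemma hact_hu (U : opens X) (h : hpair n U) (D D' : tsec U) :
  (forall x : X, smooth_at x) -> hact hn h D D' <-> D' = hu h ord0 ^+ n *: D.
Proof.
move=> sm.
have aE (V : opens X) (p : V `<=` U) (a : gaut n.+1 V) : tau a = hres p h ->
    gfun a (@subset_refl _ V) (tX _ _) (inord 1) = ores p (hu h ord0).
  move=> /(congr1 (fun k => hu k ord0)) /=; rewrite ffunE tmapE => <-; congr (_ _).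
  by apply: val_inj; rewrite /= inordK.
split=> [/hact_scale H|->]; last first.
  by apply/hact_scale => V p a /aE ->; rewrite tresZ rmorphXn.
have ex (x : U) : exists (V : opens X) (p : V `<=` U), oset V (val x) /\
    tres p D' = tres p (hu h ord0 ^+ n *: D).
  have [V [p [Vx [a ta]]]] := hpair_lift h (set_valP x) (sm _).
  by exists V, p; split=> //; rewrite (H V p a ta) aE // tresZ rmorphXn.
pose W x := projT1 (cid (ex x)); have WP x := projT2 (cid (ex x)).
apply: (@tres_sep _ _ U U W (fun x => projT1 (cid (WP x)))) => [x Ux|x].
  by exists (selt Ux) => //; have [] := projT2 (cid (WP (selt Ux))).
by have [] := projT2 (cid (WP x)).
Qed.

Section Kernel.
Variables (U : opens X) (a : gaut n.+1 U).
Hypothesis a1 : tau a = 1%g.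

Let ttr_a (V : opens X) (p : V `<=` U) f : ttr (gfun a p f) = ttr f.
Proof.
have /(congr1 (fun b : hpair n U => gfun (haut b) p (ttr f))) := a1.
by rewrite /= => <-; apply: ttr_gfun; rewrite tliftK.
Qed.

(** The component u = 1 of [tau a] prescribes the coefficients of a(t) in degrees 1 to n, and that
    of degree 0 is fixed by every [gaut]. So t is fixed modulo t^(n+1), not just modulo t^n. *)
Let a_tX (V : opens X) (p : V `<=` U) : gfun a p (tX _ _) = tX _ _.
Proof.
rewrite -(tmapX _ (ores p)) (gfun_res a (@subset_refl _ U)); congr (tmap _ _).
apply: tpolyP => k; have [k0|k0] := posnP k.
  by rewrite gfun_coef0.
have kn : (k.-1 < n)%N by rewrite -ltnS prednK.
have -> : k = lift ord0 (Ordinal kn) by apply: val_inj; rewrite /= /bump add1n prednK.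
have /(congr1 (fun b : hpair n U => hu b (Ordinal kn))) := a1.
by rewrite /= ffunE => ->; rewrite t1E tCE tXE /=; case: (k.-1).
Qed.

Let dfun (V : opens X) (p : V `<=` U) (f : ofun V) : ofun V :=
  gfun a p (tC _ f) ord_max.

Let aC (V : opens X) (p : V `<=` U) (f : ofun V) :
  gfun a p (tC _ f) = tC _ f + tC _ (dfun p f) * tX _ _ ^+ n.
Proof.
have /ttr_eq0 : ttr (gfun a p (tC _ f) - tC _ f) = 0 by rewrite rmorphB /= ttr_a subrr.
rewrite taddE toppE tCE /= subr0 => E.
by rewrite -[LHS](subrK (tC n.+1 f)) E addrC.
Qed.

(** The derivation is the coefficient of t^n in a(f), for f in O_X: as t^n squares to zero,
    multiplicativity of [a] becomes the Leibniz rule for it. *)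
Lemma tau_ker : exists D, iotaT hn D = a.
Proof.
have dB (V : opens X) (p : V `<=` U) : {morph dfun p : f g / f + g}.
  by move=> f g; rewrite /dfun rmorphD rmorphD taddE.
have dM (V : opens X) (p : V `<=` U) f g :
    dfun p (f * g) = f * dfun p g + dfun p f * g.
  apply: (@tCXn_inj n); apply: (addrI (tC _ (f * g))); rewrite -aC.
  by rewrite tCM gfunM !aC (sqr0_mul _ _ _ _ (tXn_sqr (ltn0Sn _) _)) tCD (tCM _ f) (tCM _ (dfun p f)).
have dZ (V : opens X) (p : V `<=` U) c f :
    dfun p (ocst V c * f) = ocst V c * dfun p f.
  rewrite dM [X in _ + X * _](_ : _ = 0) ?mul0r ?addr0 //.
  by rewrite /dfun gfun_cst tCE.
have dR (V W : opens X) (p : V `<=` U) (q : W `<=` U) (r : W `<=` V) f :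
    dfun q (ores r f) = ores r (dfun p f).
  by rewrite /dfun -tmapC (gfun_res a p) tmapE.
exists (TSec dB dZ dM dR); apply: gautP => V p f; rewrite iotaE /=.
have [g {1 3}->] := tpoly_decomp f.
rewrite [RHS]rmorphD [in RHS]rmorphM /= a_tX aC addrAC; congr (_ + _ + _).
(* Beyond its constant term f is t g, and a(t g) = t a(g) = t g, because a(g) - g is a multiple of
   t^n. *)
have /ttr_eq0 E : ttr (gfun a p g - g) = 0 by rewrite rmorphB /= ttr_a subrr.
by rewrite -[gfun a p g](subrK g) E mulrDr mulrCA -exprS tX_nilp mulr0 add0r.
Qed.

End Kernel.

Lemma tau_iotaT (U : opens X) (D : tsec U) : tau (iotaT hn D) = 1%g.
Proof.
apply: hpairP.
  apply: gautP => V p f; rewrite -[LHS]/(ttr (gfun (iotaT hn D) p (tlift f))) iotaE.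
  by rewrite rmorphD rmorphM rmorphXn /= ttrX tX_nilp mulr0 addr0 tliftK.
apply: tpolyP => k; rewrite ffunE iotaE taddE tXE tCM_coef tXE /= tfun0 mul0r addr0.
by rewrite t1E tCE /bump /= add1n eqSS; case: eqP.
Qed.

End Hact.

(** * A local criterion for tensor products *)

Lemma capoI (X : topologicalType) (U V W : opens X) :
  V `<=` U -> V `<=` W -> V `<=` capo U W.
Proof. by move=> p q x Vx; split; [apply: p | apply: q]. Qed.

Lemma capoL (X : topologicalType) (U V : opens X) : capo U V `<=` U.
Proof. exact: subIsetl. Qed.

Lemma capoR (X : topologicalType) (U V : opens X) : capo U V `<=` V.
Proof. exact: subIsetr. Qed.

Section TensorCriterion.
Variables (R : realType) (X : fspace R) (M N P : omod X).
Variable b : forall U, osec M U -> osec N U -> osec P U.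
Hypothesis bP : is_bilinear b.
Variables (I : Type) (U_ : I -> opens X) (e : forall i, osec N (U_ i)).
Hypothesis cov : \bigcup_i oset (U_ i) = [set: X].
Hypothesis e_gen : forall i (V : opens X) (p : V `<=` U_ i) (s : osec N V),
  exists a, s = a *: mres p (e i).
Hypothesis b_inj : forall i (V : opens X) (p : V `<=` U_ i) s s',
  b s (mres p (e i)) = b s' (mres p (e i)) -> s = s'.
Hypothesis b_surj : forall i (V : opens X) (p : V `<=` U_ i) t,
  exists s, b s (mres p (e i)) = t.

Lemma capo_cover (W : opens X) : oset W `<=` \bigcup_i oset (capo W (U_ i)).
Proof.
by move=> x Wx; have : [set: X] x by []; rewrite -cov => -[i _ Ux]; exists i.
Qed.

Section Universal.
Variables (Q : omod X) (c : forall U, osec M U -> osec N U -> osec Q U).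
Hypothesis cP : is_bilinear c.

(** Write e_j = a e_i and move a to the first argument: then b(s, e_i) determines c(s, e_i), even
    across two indices. *)
Let compat i j (V : opens X) (p : V `<=` U_ i) (q : V `<=` U_ j) s s' :
  b s (mres p (e i)) = b s' (mres q (e j)) -> c s (mres p (e i)) = c s' (mres q (e j)).
Proof.
have [a ->] := e_gen p (mres q (e j)).
by rewrite (bilZr bP) -(bilZl bP) (bilZr cP) -(bilZl cP) => /b_inj ->.
Qed.

(** The section q is the image of t under the morphism to be built. Asking this on all smaller open
    sets makes it stable under restriction; existence is by gluing, and the linearity of the
    morphism follows from uniqueness. *)
Let spec (W : opens X) (t : osec P W) (q : osec Q W) :=
  forall i (V : opens X) (pW : V `<=` W) (p : V `<=` U_ i) s,
    mres pW t = b s (mres p (e i)) -> mres pW q = c s (mres p (e i)).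

Let spec_ex (W : opens X) (t : osec P W) : exists q, spec t q.
Proof.
have pW i : capo W (U_ i) `<=` W by apply: subIsetl.
have pU i : capo W (U_ i) `<=` U_ i by apply: subIsetr.
pose s i := projT1 (cid (b_surj (pU i) (mres (pW i) t))).
have sE i : b (s i) (mres (pU i) (e i)) = mres (pW i) t.
  exact: projT2 (cid (b_surj (pU i) (mres (pW i) t))).
have sV i (V : opens X) (p : V `<=` capo W (U_ i)) :
    b (mres p (s i)) (mres (subset_trans p (pU i)) (e i)) = mres (subset_trans p (pW i)) t.
  by rewrite -(mres_comp (pU i) p) (bil_res bP) sE (mres_comp _ p (subset_trans p (pW i))).
have [i j V pi pj|q qE] := @mres_glue _ _ Q W I _ pW
    (fun i => c (s i) (mres (pU i) (e i))) (@capo_cover W).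
  rewrite -!(bil_res cP) (mres_comp _ pi (subset_trans pi (pU i))).
  rewrite (mres_comp _ pj (subset_trans pj (pU j))); apply: compat; rewrite !sV.
  by rewrite (Prop_irrelevance (subset_trans pi _) (subset_trans pj (pW j))).
exists q => i V qW p r E.
have pV : V `<=` capo W (U_ i) := capoI qW p.
rewrite -(mres_comp (pW i) pV) qE -(bil_res cP) (mres_comp _ pV (subset_trans pV (pU i))).
by apply: compat; rewrite sV -E; congr mres; apply: Prop_irrelevance.
Qed.

Let spec_uniq (W : opens X) (t : osec P W) q q' : spec t q -> spec t q' -> q = q'.
Proof.
move=> H H'; have pW i : capo W (U_ i) `<=` W by apply: subIsetl.
have pU i : capo W (U_ i) `<=` U_ i by apply: subIsetr.
apply: (@mres_sep _ _ Q W I _ pW) (@capo_cover W) _ => i.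
have [s sE] := b_surj (pU i) (mres (pW i) t).
by rewrite (H i _ _ (pU i) s) ?(H' i _ _ (pU i) s).
Qed.

Let f (U : opens X) (t : osec P U) : osec Q U := projT1 (cid (spec_ex t)).
Let fP (U : opens X) (t : osec P U) : spec t (f t) := projT2 (cid (spec_ex t)).

Lemma tensor_universal : exists f : forall U, osec P U -> osec Q U,
  [/\ is_omor f, forall U s t, f U (b s t) = c s t
    & forall f', is_omor f' -> (forall U s t, f' U (b s t) = c s t) ->
        forall U s, f' U s = f U s].
Proof.
exists f; split; first split.
- move=> U t t'; apply: (@spec_uniq U _ _ _ (@fP U _)) => i V pW p s.
  have [r rE] := b_surj p (mres pW t); have [r' rE'] := b_surj p (mres pW t').
  rewrite !mresD -rE -rE' -(bilDl bP) => /b_inj <-.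
  by rewrite (bilDl cP) (fP (esym rE)) (fP (esym rE')).
- move=> U a t; apply: (@spec_uniq U _ _ _ (@fP U _)) => i V pW p s.
  have [r rE] := b_surj p (mres pW t).
  rewrite !mresZ -rE -(bilZl bP) => /b_inj <-.
  by rewrite (bilZl cP) (fP (esym rE)).
- move=> U V p t; apply: (@spec_uniq V _ _ _ (@fP V _)) => i V' pV q s.
  by rewrite !(mres_comp _ _ (subset_trans pV p)); apply: fP.
- move=> U s t; apply: (@spec_uniq U _ _ _ (@fP U _)) => i V pW p r.
  rewrite -(bil_res bP) -(bil_res cP); have [a ->] := e_gen p (mres pW t).
  by rewrite (bilZr bP) -(bilZl bP) (bilZr cP) -(bilZl cP) => /b_inj ->.
move=> f' f'P f'b U t; apply/esym/(@spec_uniq U _ _ _ (@fP U _)) => i V pW p s E.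
by rewrite -(omor_res f'P) E f'b.
Qed.

End Universal.

Lemma is_tensor_of_generators : is_tensor M N P.
Proof. by exists b => // Q c cP; apply: tensor_universal. Qed.

End TensorCriterion.

#[local] Obligation Tactic := idtac.

(** * Line bundles given by transition functions *)

Section TwistedLine.
Variables (R : realType) (X : fspace R) (I : Type) (U_ : I -> opens X).
Hypothesis cov : \bigcup_i oset (U_ i) = [set: X].

Section Sheaf.
Variable d : forall i j, ofun (capo (U_ i) (U_ j)).

(* Sections over W of the line bundle with transition functions d i j.        *)
Record lsec (W : opens X) := LSec {
  lfun : forall i, ofun (capo W (U_ i));
  lP : forall i j (V : opens X) (pi : V `<=` capo W (U_ i))
      (pj : V `<=` capo W (U_ j)) (pij : V `<=` capo (U_ i) (U_ j)),
    ores pi (lfun i) = ores pij (d i j) * ores pj (lfun j) }.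

Section Lmod.
Variable W : opens X.

Lemma lsecP (s s' : lsec W) : (forall i, lfun s i = lfun s' i) -> s = s'.
Proof.
case: s s' => [f a] [f' a'] /= H.
have ff : f = f' by apply: functional_extensionality_dep.
by subst; f_equal; apply: Prop_irrelevance.
Qed.

HB.instance Definition _ := gen_eqMixin (lsec W).
HB.instance Definition _ := gen_choiceMixin (lsec W).

Program Definition lzero : lsec W := @LSec W (fun i => 0) _.
Next Obligation. by move=> i j V pi pj pij; rewrite !rmorph0 mulr0. Qed.

Program Definition lopp (s : lsec W) : lsec W := @LSec W (fun i => - lfun s i) _.
Next Obligation.
by move=> s i j V pi pj pij; rewrite !rmorphN /= (lP s pi pj pij) mulrN.
Qed.

Program Definition ladd (s s' : lsec W) : lsec W :=
  @LSec W (fun i => lfun s i + lfun s' i) _.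
Next Obligation.
by move=> s s' i j V pi pj pij; rewrite !rmorphD /= !(lP _ pi pj pij) mulrDr.
Qed.

Program Definition lscale (a : ofun W) (s : lsec W) : lsec W :=
  @LSec W (fun i => ores (@subIsetl _ _ _ : capo W (U_ i) `<=` W) a * lfun s i) _.
Next Obligation.
move=> a s i j V pi pj pij; have q : V `<=` W by move=> x /pi [].
by rewrite !rmorphM /= !(ores_comp _ _ q) (lP s pi pj pij) mulrCA.
Qed.

Fact laddA : associative ladd.
Proof. by move=> s s' s''; apply: lsecP => i /=; rewrite addrA. Qed.
Fact laddC : commutative ladd.
Proof. by move=> s s'; apply: lsecP => i /=; rewrite addrC. Qed.
Fact ladd0 : left_id lzero ladd.
Proof. by move=> s; apply: lsecP => i /=; rewrite add0r. Qed.
Fact laddN : left_inverse lzero lopp ladd.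
Proof. by move=> s; apply: lsecP => i /=; rewrite addNr. Qed.
HB.instance Definition _ := GRing.isZmodule.Build (lsec W) laddA laddC ladd0 laddN.

Fact lscaleA a b s : lscale a (lscale b s) = lscale (a * b) s.
Proof. by apply: lsecP => i /=; rewrite rmorphM mulrA. Qed.
Fact lscale1 : left_id 1 lscale.
Proof. by move=> s; apply: lsecP => i /=; rewrite rmorph1 mul1r. Qed.
Fact lscaleDr : right_distributive lscale +%R.
Proof. by move=> a s s'; apply: lsecP => i /=; rewrite mulrDr. Qed.
Fact lscaleDl s : {morph lscale^~ s : a b / a + b}.
Proof. by move=> a b; apply: lsecP => i /=; rewrite rmorphD mulrDl. Qed.
HB.instance Definition _ :=
  GRing.Zmodule_isLmodule.Build (ofun W) (lsec W) lscaleA lscale1 lscaleDr lscaleDl.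

End Lmod.

Program Definition lres (W V : opens X) (p : V `<=` W) (s : lsec W) : lsec V :=
  @LSec V (fun i => ores (@capoS _ _ _ _ (U_ i) p) (lfun s i)) _.
Next Obligation.
move=> W V p s i j V' pi pj pij.
rewrite (ores_comp _ _ (subset_trans pi (@capoS _ _ _ _ (U_ i) p))).
rewrite (ores_comp _ _ (subset_trans pj (@capoS _ _ _ _ (U_ j) p))).
exact: lP.
Qed.

Fact lresD (U V : opens X) (p : V `<=` U) : {morph lres p : s s' / s + s'}.
Proof. by move=> s s'; apply: lsecP => i /=; rewrite rmorphD. Qed.
Fact lresZ (U V : opens X) (p : V `<=` U) a s : lres p (a *: s) = ores p a *: lres p s.
Proof.
apply: lsecP => i /=; rewrite rmorphM /=; congr (_ * _).
have q : capo V (U_ i) `<=` U by move=> x [/p].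
by rewrite !(ores_comp _ _ q).
Qed.
Fact lres_id (U : opens X) (p : U `<=` U) s : lres p s = s.
Proof. by apply: lsecP => i; apply: ores_id. Qed.
Fact lres_comp (U V W : opens X) (p : V `<=` U) (q : W `<=` V) (r : W `<=` U) s :
  lres q (lres p s) = lres r s.
Proof. by apply: lsecP => i; apply: ores_comp. Qed.

Fact lres_sep (U : opens X) (J : Type) (W : J -> opens X)
    (p : forall i, W i `<=` U) (s s' : lsec U) :
  oset U `<=` \bigcup_i oset (W i) ->
  (forall i, lres (p i) s = lres (p i) s') -> s = s'.
Proof.
move=> cW H; apply: lsecP => i.
apply: (ofun_sep (p := fun k => @capoS _ _ _ _ (U_ i) (p k))) => [x [Ux Uix]|k].
  by have [k _ Wx] := cW _ Ux; exists k.
exact (congr1 (fun s => lfun s i) (H k)).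
Qed.

Fact lres_glue (U : opens X) (J : Type) (W : J -> opens X)
    (p : forall i, W i `<=` U) (s : forall i, lsec (W i)) :
  oset U `<=` \bigcup_i oset (W i) ->
  (forall i j (V : opens X) (pi : V `<=` W i) (pj : V `<=` W j),
     lres pi (s i) = lres pj (s j)) ->
  exists s' : lsec U, forall i, lres (p i) s' = s i.
Proof.
move=> cW H; pose pW i k := @capoS _ _ _ _ (U_ i) (p k).
have ex i : exists f : ofun (capo U (U_ i)), forall k, ores (pW i k) f = lfun (s k) i.
  apply: ofun_glue => [x [Ux Uix]|k l V pk pl].
    by have [k _ Wx] := cW _ Ux; exists k.
  have qk : V `<=` W k by move=> x /pk [].
  have ql : V `<=` W l by move=> x /pl [].
  have Vi : V `<=` U_ i by move=> x /pl [].
  have /(congr1 (fun s => ores (capoI (@subset_refl _ _) Vi) (lfun s i))) := H k l V qk ql.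
  by rewrite /= !(ores_comp _ _ pk) !(ores_comp _ _ pl).
pose f i := projT1 (cid (ex i)).
have fE i k : ores (pW i k) (f i) = lfun (s k) i := projT2 (cid (ex i)) k.
have fP i j (V : opens X) (pi : V `<=` capo U (U_ i)) (pj : V `<=` capo U (U_ j))
    (pij : V `<=` capo (U_ i) (U_ j)) :
    ores pi (f i) = ores pij (d i j) * ores pj (f j).
  have VW k : capo V (W k) `<=` V by apply: subIsetl.
  apply: (ofun_sep (p := VW)) => [x Vx|k].
    by have [Ux _] := pi _ Vx; have [k _ Wx] := cW _ Ux; exists k.
  have qi : capo V (W k) `<=` capo (W k) (U_ i) by move=> x [/pi[_ Uix] Wx].
  have qj : capo V (W k) `<=` capo (W k) (U_ j) by move=> x [/pj[_ Ujx] Wx].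
  rewrite rmorphM /= (ores_comp _ _ (subset_trans qi (pW i k))) -(ores_comp (pW i k) qi) fE.
  rewrite (ores_comp pj _ (subset_trans qj (pW j k))) -(ores_comp (pW j k) qj) fE.
  by rewrite (ores_comp pij _ (subset_trans (VW k) pij)); apply: lP.
by exists (LSec fP) => k; apply: lsecP => i /=; rewrite fE.
Qed.

Definition Ltw : omod X :=
  @OMod R X lsec lres lresD lresZ lres_id lres_comp lres_sep lres_glue.

End Sheaf.

Definition is_ococycle (d : forall i j, ofun (capo (U_ i) (U_ j))) : Prop :=
  (forall i, d i i = 1) /\
  forall i j k (V : opens X) (pij : V `<=` capo (U_ i) (U_ j))
    (pjk : V `<=` capo (U_ j) (U_ k)) (pik : V `<=` capo (U_ i) (U_ k)),
    ores pij (d i j) * ores pjk (d j k) = ores pik (d i k).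

Section Cocycle.
Variable d : forall i j, ofun (capo (U_ i) (U_ j)).
Hypothesis dP : is_ococycle d.

Lemma lgen_subproof i j : capo (U_ i) (U_ j) `<=` capo (U_ j) (U_ i).
Proof. by move=> x []. Qed.

(** The generator over U_i whose i-th component is d_ii = 1; the transition rule then forces d_ji as
    the j-th one. *)
Program Definition lgen i : lsec d (U_ i) :=
  @LSec d (U_ i) (fun j => ores (@lgen_subproof i j) (d j i)) _.
Next Obligation.
move=> i j k V pj pk pjk.
rewrite (ores_comp _ pj (subset_trans pj (@lgen_subproof i j))).
rewrite (ores_comp _ pk (subset_trans pk (@lgen_subproof i k))).
by rewrite (dP.2 _ _ _ _ _ _ (subset_trans pj (@lgen_subproof i j))).
Qed.

Lemma lgenE i (V W : opens X) (p : V `<=` U_ i) (q : W `<=` capo V (U_ i)) :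
  ores q (lfun (lres p (lgen i)) i) = 1.
Proof. by rewrite /= dP.1 !rmorph1. Qed.

Lemma lgenP i (V : opens X) (p : V `<=` U_ i) (s : osec (Ltw d) V) :
  s = ores (capoI (@subset_refl _ V) p) (lfun s i) *: mres p (lgen i : osec (Ltw d) (U_ i)).
Proof.
apply: lsecP => j /=.
have q : capo V (U_ j) `<=` capo V (U_ i) by move=> x [Vx _]; split=> //; apply: p.
have r : capo V (U_ j) `<=` capo (U_ j) (U_ i) by move=> x [Vx Ujx]; split=> //; apply: p.
rewrite !(ores_comp _ _ q) !(ores_comp _ _ r) mulrC -(lP s (@subset_refl _ _) q r).
by rewrite ores_id.
Qed.

End Cocycle.

Section Tensor.
Variable d : forall i j, ofun (capo (U_ i) (U_ j)).
Hypothesis dP : is_ococycle d.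
Variables (M P : omod X).
Variable al : forall i (V : opens X), V `<=` U_ i -> osec P V -> osec M V.
Hypothesis alD : forall i (V : opens X) (p : V `<=` U_ i), {morph al p : t t' / t + t'}.
Hypothesis alZ : forall i (V : opens X) (p : V `<=` U_ i) a t, al p (a *: t) = a *: al p t.
Hypothesis al_res : forall i (V W : opens X) (p : V `<=` U_ i) (q : W `<=` U_ i)
  (r : W `<=` V) t, al q (mres r t) = mres r (al p t).
Hypothesis al_inj : forall i (V : opens X) (p : V `<=` U_ i), injective (al p).
Hypothesis al_surj : forall i (V : opens X) (p : V `<=` U_ i) s, exists t, al p t = s.
Hypothesis al_cocycle : forall i j (V : opens X) (pi : V `<=` U_ i) (pj : V `<=` U_ j) t,
  al pi t = ores (capoI pi pj) (d i j) *: al pj t.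

(** Here t stands for the tensor m times s. The maps [al] are trivialisations of P by M over the
    U_i; the rules s_i = d_ij s_j and al_i = d_ij al_j make the local solutions agree on
    overlaps. *)
Let spec (W : opens X) (m : osec M W) (s : lsec d W) (t : osec P W) :=
  forall i (V : opens X) (p : V `<=` W) (q : V `<=` U_ i),
    al q (mres p t) = ores (capoI p q) (lfun s i) *: mres p m.

Let spec_ex (W : opens X) (m : osec M W) (s : lsec d W) : exists t, spec m s t.
Proof.
have pW i : capo W (U_ i) `<=` W by apply: subIsetl.
have pU i : capo W (U_ i) `<=` U_ i by apply: subIsetr.
pose t i := projT1 (cid (al_surj (pU i) (lfun s i *: mres (pW i) m))).
have tE i : al (pU i) (t i) = lfun s i *: mres (pW i) m.
  exact: projT2 (cid (al_surj (pU i) (lfun s i *: mres (pW i) m))).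
have [i j V pi pj|t' t'E] := @mres_glue _ _ P W I _ pW t (@capo_cover _ _ _ _ cov W).
  have qi := subset_trans pi (pU i); have qj := subset_trans pj (pU j).
  apply: (al_inj (p := qi)); rewrite (al_res (pU i)) tE (al_cocycle qi qj).
  rewrite (al_res (pU j)) tE !mresZ scalerA -(lP s pi pj); congr (_ *: _).
  by rewrite !(mres_comp _ _ (subset_trans pi (pW i))).
exists t' => i V p q; rewrite -(mres_comp (pW i) (capoI p q)) t'E (al_res (pU i)) tE.
by rewrite mresZ (mres_comp _ _ p).
Qed.

Let spec_uniq (W : opens X) (m : osec M W) (s : lsec d W) t t' :
  spec m s t -> spec m s t' -> t = t'.
Proof.
move=> H H'; have pW i : capo W (U_ i) `<=` W by apply: subIsetl.
have pU i : capo W (U_ i) `<=` U_ i by apply: subIsetr.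
apply: (@mres_sep _ _ P W I _ pW) (@capo_cover _ _ _ _ cov W) _ => i.
by apply: (al_inj (p := pU i)); rewrite H H'.
Qed.

Let b (U : opens X) (m : osec M U) (s : osec (Ltw d) U) : osec P U :=
  projT1 (cid (spec_ex m s)).
Let bP (U : opens X) (m : osec M U) (s : osec (Ltw d) U) : spec m s (b m s) :=
  projT2 (cid (spec_ex m s)).

Lemma is_tensor_twist : is_tensor M (Ltw d) P.
Proof.
have bil : is_bilinear b.
  split.
  - move=> U m m' s; apply: (@spec_uniq U _ _ _ _ (@bP U _ _)) => i V p q.
    by rewrite !mresD alD !bP scalerDr.
  - move=> U m s s'; apply: (@spec_uniq U _ _ _ _ (@bP U _ _)) => i V p q.
    by rewrite !mresD alD !bP -scalerDl /= rmorphD.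
  - move=> U a m s; apply: (@spec_uniq U _ _ _ _ (@bP U _ _)) => i V p q.
    by rewrite !mresZ alZ !bP !scalerA mulrC.
  - move=> U a m s; apply: (@spec_uniq U _ _ _ _ (@bP U _ _)) => i V p q.
    by rewrite mresZ alZ !bP !scalerA /= rmorphM /= (ores_comp _ _ p).
  - move=> U V p m s; apply: (@spec_uniq V _ _ _ _ (@bP V _ _)) => i W q r.
    rewrite !(mres_comp _ _ (subset_trans q p)) bP /=.
    by rewrite (ores_comp _ _ (capoI (subset_trans q p) r)).
(* As d_ii = 1, tensoring with the generator over U_i is inverse to [al] there, which gives the
   bijectivity asked by the criterion. *)
have al_b i (V : opens X) (p : V `<=` U_ i) m :
    al p (b m (mres p (lgen dP i : osec (Ltw d) _))) = m.
  have := bP m (mres p (lgen dP i : osec (Ltw d) _)) (@subset_refl _ V) p.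
  by rewrite !mres_id (lgenE dP) scale1r.
apply: (is_tensor_of_generators bil (e := lgen dP) cov).
- by move=> i V p s; exists (ores (capoI (@subset_refl _ V) p) (lfun s i)); apply: lgenP.
- by move=> i V p m m' /(congr1 (al p)); rewrite !al_b.
- by move=> i V p t; exists (al p t); apply: (al_inj (p := p)); rewrite al_b.
Qed.

End Tensor.

Lemma oiso_Ltw1 (d : forall i j, ofun (capo (U_ i) (U_ j))) :
  (forall i j, d i j = 1) -> oiso (OX X) (Ltw d).
Proof.
move=> d1.
have dP (U : opens X) (a : ofun U) i j (V : opens X) (pi : V `<=` capo U (U_ i))
    (pj : V `<=` capo U (U_ j)) (pij : V `<=` capo (U_ i) (U_ j)) :
    ores pi (ores (@subIsetl _ _ _ : capo U (U_ i) `<=` U) a) =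
    ores pij (d i j) * ores pj (ores (@subIsetl _ _ _ : capo U (U_ j) `<=` U) a).
  have q : V `<=` U by move=> x /pi [].
  by rewrite d1 rmorph1 mul1r !(ores_comp _ _ q).
pose f (U : opens X) (a : osec (OX X) U) : osec (Ltw d) U := LSec (dP U a).
exists f.
  split.
  - by move=> U s s'; apply: lsecP => i /=; rewrite rmorphD.
  - by move=> U a s; apply: lsecP => i /=; rewrite rmorphM.
  - move=> U V p s; apply: lsecP => i /=.
    have q : capo V (U_ i) `<=` U by move=> x [/p].
    by rewrite !(ores_comp _ _ q).
move=> U; have f_inj : injective (f U).
  move=> a a' E; apply: (ofun_sep (p := fun i => @subIsetl _ _ _ : capo U (U_ i) `<=` U)).
    exact: (@capo_cover _ _ _ _ cov U).
  by move=> i; exact (congr1 (fun s => lfun s i) E).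
have f_surj s : exists a, f U a = s.
  have [i j V pi pj|a aE] := @ofun_glue _ _ U I (fun i => capo U (U_ i))
      (fun i => @subIsetl _ _ _) (lfun s) (@capo_cover _ _ _ _ cov U).
    have pij : V `<=` capo (U_ i) (U_ j) by move=> x Vx; split; [case: (pi x Vx) | case: (pj x Vx)].
    by rewrite (lP s pi pj pij) d1 rmorph1 mul1r.
  by exists a; apply: lsecP => i; apply: aE.
exists (fun s => projT1 (cid (f_surj s))) => s; last exact: projT2 (cid (f_surj s)).
by apply: f_inj; exact: projT2 (cid (f_surj (f U s))).
Qed.

End TwistedLine.

Lemma ococycleX (R : realType) (X : fspace R) (I : Type) (U_ : I -> opens X)
    (d : forall i j, ofun (capo (U_ i) (U_ j))) k :
  is_ococycle d -> is_ococycle (fun i j => d i j ^+ k).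
Proof.
move=> [d1 dM]; split=> [i|i j l V pij pjl pil]; first by rewrite d1 expr1n.
by rewrite !rmorphXn -exprMn; congr (_ ^+ _); apply: dM.
Qed.

(** * The conormal sheaf, its powers, and the twisted tangent sheaf *)

Section Conormal.
Variables (R : realType) (X : fspace R) (m : nat).
Local Notation n := m.+2.
Variables (I : Type) (U_ : I -> opens X).
Variable h : forall i j, hpair n (capo (U_ i) (U_ j)).
Hypothesis hP : is_cocycle h.
Local Notation phi := (fun i j => haut (h i j)).

Lemma phi_comp i j k (V : opens X) (pij : V `<=` capo (U_ i) (U_ j))
    (pjk : V `<=` capo (U_ j) (U_ k)) (pik : V `<=` capo (U_ i) (U_ k)) f :
  gfun (phi i j) pij (gfun (phi j k) pjk f) = gfun (phi i k) pik f.
Proof.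
have /(congr1 (fun a => gfun (haut a) (@subset_refl _ V) f)) := hP pij pjk pik.
by rewrite /= !(gfun_irr _ (subset_trans _ _) pij) !(gfun_irr _ (subset_trans _ _) pjk)
  !(gfun_irr _ (subset_trans _ _) pik).
Qed.

(** By the cocycle relation this map is idempotent, and it is injective. *)
Lemma phi_id i (V : opens X) (p : V `<=` capo (U_ i) (U_ i)) f : gfun (phi i i) p f = f.
Proof. by apply: (can_inj (gfunK (phi i i) p)); apply: phi_comp. Qed.

Definition ccoef i j : ofun (capo (U_ i) (U_ j)) := hu (h i j) ord0.

(** The diagonal case compares coefficients of t in t = u_ii t. In general take the constant term of
    u_ij phi_ij(u_jk), phi_ij being the identity modulo t. *)
Lemma ccoef_cocycle : is_ococycle ccoef.
Proof.
split=> [i|i j k V pij pjk pik].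
  have := haut_t (h i i); rewrite phi_id [_ * tX n _]mulrC.
  move=> /(congr1 (fun f : tpoly n _ => f (lift ord0 ord0))).
  by rewrite (@tXM_coef _ _ _ _ ord0) // tXE /ccoef => <-.
have /(congr1 (fun a => hu a ord0)) := hP pij pjk pik.
by rewrite /= tcoef0M gfun_coef0 // !tmapE.
Qed.

Section Lift.
Variables (i : I) (V : opens X) (p : V `<=` U_ i).

Let pc j : capo V (U_ j) `<=` V := @subIsetl _ _ _.
Let pu j : capo V (U_ j) `<=` capo (U_ j) (U_ i) := fun x H => conj H.2 (p H.1).

(* Over [V], contained in [U_ i], sections of [Y] are given by their [i]-th   *)
(* component.                                                                 *)
Program Definition ylift (f : tpoly n (ofun V)) : ysec phi V :=
  @YSec R X n I U_ phi V (fun j => gfun (phi j i) (@pu j) (tmap (ores (@pc j)) f)) _.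
Next Obligation.
move=> f j k V' pj pk pjk.
have qj := subset_trans pj (@pu j); have qk := subset_trans pk (@pu k).
rewrite -(gfun_res (phi j i) (@pu j) qj) -(gfun_res (phi k i) (@pu k) qk) phi_comp.
congr (gfun _ _ _); apply: tpolyP => l.
by rewrite !tmapE /= !(ores_comp _ _ (subset_trans pj (@pc j))).
Qed.

Definition yat (s : ysec phi V) : tpoly n (ofun V) :=
  tmap (ores (capoI (@subset_refl _ V) p)) (yfun s i).

Fact yat_zmod : zmod_morphism yat.
Proof. by move=> s s'; rewrite /yat -rmorphB. Qed.
Fact yat_monoid : monoid_morphism yat.
Proof.
split; first exact: (rmorph1 (tmap (ores (capoI (@subset_refl _ V) p)))).
by move=> s s'; rewrite /yat -rmorphM.
Qed.
HB.instance Definition _ :=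
  GRing.isZmodMorphism.Build (ysec phi V) (tpoly n (ofun V)) yat yat_zmod.
HB.instance Definition _ :=
  GRing.isMonoidMorphism.Build (ysec phi V) (tpoly n (ofun V)) yat yat_monoid.

Lemma yliftK : cancel ylift yat.
Proof.
move=> f; rewrite /yat /= phi_id; apply: tpolyP => k.
by rewrite !tmapE /= (ores_comp _ _ (@subset_refl _ V)) ores_id.
Qed.

Lemma yatK : cancel yat ylift.
Proof.
move=> s; apply: ysecP => j /=.
have q : capo V (U_ j) `<=` capo V (U_ i) by move=> x [Vx _]; split=> //; apply: p.
have := yP s (@subset_refl _ (capo V (U_ j))) q (@pu j).
have -> : tmap (ores (@subset_refl _ (capo V (U_ j)))) (yfun s j) = yfun s j.
  by apply: tpolyP => k; rewrite tmapE /= ores_id.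
move=> ->; congr (gfun _ _ _); apply: tpolyP => k.
by rewrite !tmapE /= (ores_comp _ _ q).
Qed.

Lemma yred_ylift f : yred (ylift f) (f ord0).
Proof.
by move=> j; apply: in_tP => k k0; rewrite taddE toppE gfun_coef0 // tCE k0 eqxx tmapE
  (_ : k = ord0) ?subrr //; apply: val_inj.
Qed.

Lemma yred_yat s a : yred s a -> yat s ord0 = a.
Proof.
move=> /(_ i) H; have := in_t_coef0 H (erefl : val (ord0 : 'I_n) = 0%N).
rewrite taddE toppE tCE /= => /eqP; rewrite subr_eq0 => /eqP E.
by rewrite tmapE E /= (ores_comp _ _ (@subset_refl _ V)) ores_id.
Qed.

End Lift.

Lemma ylift_res i (V W : opens X) (p : V `<=` U_ i) (q : W `<=` U_ i) (r : W `<=` V) f :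
  yres r (ylift p f) = ylift q (tmap (ores r) f).
Proof.
apply: (can_inj (yatK q)); rewrite yliftK /yat /= phi_id; apply: tpolyP => k.
have t : capo W (U_ i) `<=` V by move=> x [/r].
by rewrite !tmapE /= (ores_comp _ _ t) (ores_comp _ _ r).
Qed.

Lemma IX_ylift i (V : opens X) (p : V `<=` U_ i) s : in_IX s ->
  exists f, s = ylift p f * ylift p (tX n _).
Proof.
move=> sI; have [f fE] : in_t (yat p s).
  apply: in_tP => k k0; rewrite (_ : k = ord0); last exact: val_inj.
  exact: yred_yat.
by exists f; apply: (can_inj (yatK p)); rewrite rmorphM /= !yliftK mulrC fE.
Qed.

Lemma ylift_IX i (V : opens X) (p : V `<=` U_ i) : in_IX (ylift p (tX n _)).
Proof. by have := yred_ylift p (tX n _); rewrite tXE. Qed.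

(** Locally the section is a sum of products of two multiples of t, hence a multiple of t^2. *)
Lemma IX2_coef1 i (V : opens X) (p : V `<=` U_ i) f :
  in_IX2 (ylift p f) -> f (lift ord0 ord0) = 0.
Proof.
move=> H; apply: ofunP => x; have [W [r [Wx [k [a [b [ab E]]]]]]] := H _ (set_valP x).
have q := subset_trans r p.
have : tmap (ores r) f (lift ord0 ord0) = 0.
  have := congr1 (yat q) E; rewrite (ylift_res p q) yliftK rmorph_sum => ->.
  rewrite sum_ffunE big1 // => l _; have [/(IX_ylift q)[a' ->] /(IX_ylift q)[b' ->]] := ab l.
  rewrite !rmorphM /= !yliftK mulrACA mulrC -mulrA (@tXM_coef _ _ _ _ ord0) //.
  by rewrite tXM_coef0.
rewrite tmapE => /(congr1 (fun g : ofun W => g (selt Wx))); rewrite oresE => E0.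
by apply: etrans E0; congr (oval _ _); apply: val_inj.
Qed.

Section Generators.
Variables (L : omod X) (pi : forall W, ysec phi W -> osec L W).
Hypothesis piP : is_conormal_map pi.

Definition conormal_gen i : osec L (U_ i) := pi (ylift (@subset_refl _ (U_ i)) (tX n _)).
Local Notation eps := conormal_gen.

Lemma eps_res i (V : opens X) (p : V `<=` U_ i) :
  mres p (eps i) = pi (ylift p (tX n _)).
Proof. by rewrite -(cn_res piP) ?(ylift_res _ p) ?tmapX //; apply: ylift_IX. Qed.

(** Functions on Y act on I_X/I_X^2 through their restrictions to X, that is, through their constant
    terms over U_i. *)
Lemma pi_ylift i (V : opens X) (p : V `<=` U_ i) f :
  pi (ylift p f * ylift p (tX n _)) = f ord0 *: mres p (eps i).
Proof. by rewrite eps_res -(cnZ piP (yred_ylift p f)) //; apply: ylift_IX. Qed.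

(** If d annihilates the generator, then d t lies in I_X^2, so its coefficient d in degree 1
    vanishes. *)
Lemma eps_free i (V : opens X) (p : V `<=` U_ i) a a' :
  a *: mres p (eps i) = a' *: mres p (eps i) -> a = a'.
Proof.
move=> /eqP; rewrite -subr_eq0 -scalerBl => /eqP E; apply/eqP; rewrite -subr_eq0; apply/eqP.
set d := a - a' in E *.
have dI : in_IX (ylift p (tC n d * tX n _)).
  by have := yred_ylift p (tC n d * tX n _); rewrite tcoef0M tXE mulr0.
have dE : ylift p (tC n d * tX n _) = ylift p (tC n d) * ylift p (tX n _).
  by apply: (can_inj (yatK p)); rewrite rmorphM /= !yliftK.
have /(cn_ker piP dI) /IX2_coef1 : pi (ylift p (tC n d * tX n _)) = 0.
  by rewrite dE pi_ylift tCE.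
by rewrite tCM_coef tXE mulr1.
Qed.

(** A section of L lifts to I_X only locally. The coefficients found there are unique by [eps_free],
    so they glue. *)
Lemma eps_gen i (V : opens X) (p : V `<=` U_ i) (l : osec L V) :
  exists a, l = a *: mres p (eps i).
Proof.
have ex (x : V) : exists (W : opens X) (q : W `<=` V), oset W (val x) /\
    exists a, mres q l = a *: mres (subset_trans q p) (eps i).
  have [W [q [Wx [s sI sE]]]] := cn_surj piP l (set_valP x).
  exists W, q; split=> //; have [f fE] := IX_ylift (subset_trans q p) sI.
  by exists (f ord0); rewrite -sE fE pi_ylift.
pose W x := projT1 (cid (ex x)); have exW x := projT2 (cid (ex x)).
pose q x : W x `<=` V := projT1 (cid (exW x)).
have WP x := projT2 (cid (exW x)).
pose a x := projT1 (cid (WP x).2).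
have aE x : mres (q x) l = a x *: mres (subset_trans (q x) p) (eps i).
  exact: projT2 (cid (WP x).2).
have covW : oset V `<=` \bigcup_x oset (W x).
  by move=> x Vx; exists (selt Vx) => //; exact: (WP (selt Vx)).1.
have aV x (V' : opens X) (r : V' `<=` W x) :
    ores r (a x) *: mres (subset_trans (subset_trans r (q x)) p) (eps i) =
    mres (subset_trans r (q x)) l.
  rewrite -(mres_comp (q x) r) aE mresZ; congr (_ *: _).
  by rewrite (mres_comp _ _ (subset_trans (subset_trans r (q x)) p)).
have [x y V' rx ry|b bE] := @ofun_glue _ _ V _ W q a covW.
  apply: (eps_free (p := subset_trans (subset_trans rx (q x)) p)); rewrite aV.
  rewrite (Prop_irrelevance (subset_trans (subset_trans rx _) p)
                            (subset_trans (subset_trans ry (q y)) p)).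
  by rewrite aV (Prop_irrelevance (subset_trans rx _) (subset_trans ry (q y))).
exists b; apply: (@mres_sep _ _ L V _ W q) => // x.
by rewrite aE mresZ bE (mres_comp _ _ (subset_trans (q x) p)).
Qed.

(** The i-th component of the section equal to t over U_j is phi_ij(t) = u_ij t, whose class
    involves only the constant term of u_ij. *)
Lemma eps_cocycle i j (V : opens X) (p : V `<=` U_ i) (q : V `<=` U_ j) :
  mres q (eps j) = ores (capoI p q) (ccoef i j) *: mres p (eps i).
Proof.
rewrite -tmapE -pi_ylift eps_res; congr (pi _); apply: (can_inj (yatK p)).
rewrite rmorphM /= !yliftK /yat /=.
rewrite -(gfun_res (haut (h i j)) _ (capoI p q)) -(haut_tX (capoI p q)); congr (gfun _ _ _).
by rewrite !tmapX.
Qed.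

Lemma is_tensor_power_conormal k : \bigcup_i oset (U_ i) = [set: X] ->
  is_tensor_power L k (Ltw (fun i j => ccoef i j ^+ k)).
Proof.
move=> cov; elim: k => [|k IH]; first exact: oiso_Ltw1.
exists (Ltw (fun i j => ccoef i j ^+ k)) => //.
have dk := ococycleX k ccoef_cocycle; have dk1 := ococycleX k.+1 ccoef_cocycle.
pose P := Ltw (fun i j => ccoef i j ^+ k.+1).
(* One of the k + 1 factors c_ij is absorbed by the change of generator: t_i e_i = c_ij^(k+1) t_j
   e_i = c_ij^k t_j e_j. So these trivialisations by L have transition functions c_ij^k. *)
pose al i (V : opens X) (p : V `<=` U_ i) (t : osec P V) : osec L V :=
  ores (capoI (@subset_refl _ V) p) (lfun t i) *: mres p (eps i).
apply: (is_tensor_twist cov dk (P := P) (al := al)).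
- by move=> i V p t t'; rewrite /al /= rmorphD scalerDl.
- move=> i V p a t; rewrite /al /= rmorphM scalerA /=.
  by rewrite (ores_comp _ _ (@subset_refl _ V)) ores_id.
- move=> i V W p q r t; rewrite /al mresZ (mres_comp _ _ q) /=.
  by rewrite !(ores_comp _ _ (capoI r q)).
- move=> i V p t t' /eps_free E.
  by rewrite (lgenP dk1 p t) (lgenP dk1 p t') E.
- move=> i V p s; have [a ->] := eps_gen p s.
  exists (a *: mres p (lgen dk1 i : osec P (U_ i))).
  rewrite /al /= rmorphM /= dk1.1 !rmorph1 mulr1.
  by rewrite (ores_comp _ _ (@subset_refl _ V)) ores_id.
move=> i j V p q t; rewrite /al (eps_cocycle p q) !scalerA; congr (_ *: _).
by rewrite (lP t _ (capoI (@subset_refl _ V) q) (capoI p q)) !rmorphXn /= exprSr mulrAC.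
Qed.

End Generators.

(** By [hact_hu] the gluing condition reads D_i = c_ij^n D_j, so taking the i-th component
    trivialises the twisted sheaf over U_i, with transition functions c_ij^n. *)
Lemma is_tensor_TXtw (hn : (1 < n)%N) : \bigcup_i oset (U_ i) = [set: X] ->
  (forall x : X, smooth_at x) ->
  is_tensor (TX X) (Ltw (fun i j => ccoef i j ^+ n)) (TXtw hn h).
Proof.
move=> cov sm; have dn := ococycleX n ccoef_cocycle.
pose P := TXtw hn h.
have twE (W : opens X) (t : twsec hn h W) i j (V : opens X) (pi : V `<=` capo W (U_ i))
    (pj : V `<=` capo W (U_ j)) (pij : V `<=` capo (U_ i) (U_ j)) :
    tres pi (twfun t i) = ores pij (ccoef i j ^+ n) *: tres pj (twfun t j).
  by have /(hact_hu _ _ _ _ sm) := @twP _ _ _ _ _ _ _ _ t i j V pi pj pij; rewrite tmapE -rmorphXn.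
pose al i (V : opens X) (p : V `<=` U_ i) (t : osec P V) : osec (TX X) V :=
  tres (capoI (@subset_refl _ V) p) (twfun t i).
apply: (is_tensor_twist cov dn (P := P) (al := al)).
- by move=> i V p t t'; rewrite /al /= tresD.
- move=> i V p a t; rewrite /al /= tresZ.
  by rewrite (ores_comp _ _ (@subset_refl _ V)) ores_id.
- move=> i V W p q r t; rewrite /al /=.
  by rewrite !(tres_comp _ _ (capoI r q)).
- move=> i V p t t' E; apply: twsecP => j.
  have q : capo V (U_ j) `<=` capo V (U_ i)
    := capoI (@capoL _ _ _) (subset_trans (@capoL _ _ _) p).
  have r : capo V (U_ j) `<=` capo (U_ j) (U_ i)
    := capoI (@capoR _ _ _) (subset_trans (@capoL _ _ _) p).
  rewrite -[LHS](tres_id (@subset_refl _ _)) -[RHS](tres_id (@subset_refl _ _)).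
  rewrite !(twE _ _ j i _ _ q r); congr (_ *: _).
  have := congr1 (tres (@capoL _ V (U_ j))) E.
  by rewrite /al !(tres_comp _ _ q).
(* Over U_i the section with i-th component D has c_ji^n D as its j-th component; these satisfy the
   gluing condition because c_jk c_ki = c_ji. *)
- move=> i V p D.
  have r j : capo V (U_ j) `<=` capo (U_ j) (U_ i)
    := capoI (@capoR _ _ _) (subset_trans (@capoL _ _ _) p).
  have s j : capo V (U_ j) `<=` V by apply: subIsetl.
  have tP j k (V' : opens X) (pj : V' `<=` capo V (U_ j)) (pk : V' `<=` capo V (U_ k))
      (pjk : V' `<=` capo (U_ j) (U_ k)) :
      hact hn (hres pjk (h j k)) (tres pk (ores (r k) (ccoef k i ^+ n) *: tres (s k) D))
        (tres pj (ores (r j) (ccoef j i ^+ n) *: tres (s j) D)).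
    apply/(hact_hu _ _ _ _ sm); rewrite !tresZ scalerA tmapE -rmorphXn.
    rewrite (ores_comp _ _ (subset_trans pk (r k))) (ores_comp _ _ (subset_trans pj (r j))).
    rewrite (dn.2 _ _ _ _ _ _ (subset_trans pj (r j))); congr (_ *: _).
    by rewrite !(tres_comp _ _ (subset_trans pj (s j))).
  exists (@TWSec R X n hn I U_ h V (fun j => ores (r j) (ccoef j i ^+ n) *: tres (s j) D) tP).
  rewrite /al /= tresZ dn.1 !rmorph1 scale1r.
  by rewrite (tres_comp _ _ (@subset_refl _ V)) tres_id.
by move=> i j V p q t; rewrite /al (twE _ _ i j _ _ (capoI (@subset_refl _ V) q) (capoI p q)).
Qed.

End Conormal.

Theorem proposition4p5p2 (R : realType) (X : fspace R)
    (hX : smooth_connected_variety X) (n : nat) (hn : (1 < n)%N) :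
  (* iotaT : T_X -> ker (tau_n) is an isomorphism of sheaves of groups *)
  [/\ forall (U : opens X) (D E : tsec U),
        iotaT hn (D + E) = (iotaT hn D * iotaT hn E)%g,
      forall (U V : opens X) (p : V `<=` U) (D : tsec U),
        iotaT hn (tres p D) = gres p (iotaT hn D),
      forall (U : opens X) (D E : tsec U), iotaT hn D = iotaT hn E -> D = E
    & forall (U : opens X) (a : gaut n.+1 U),
        tau a = 1%g <-> exists D : tsec U, iotaT hn D = a] /\
  (* T_X^g is isomorphic to the tensor product of T_X and L^n *)
  (forall (I : Type) (U_ : I -> opens X)
     (h : forall i j : I, hpair n (capo (U_ i) (U_ j))) (L : omod X),
     \bigcup_i oset (U_ i) = [set: X] ->
     is_cocycle h ->
     is_conormal (fun i j => haut (h i j)) L ->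
     exists2 Ln : omod X, is_tensor_power L n Ln & is_tensor (TX X) Ln (TXtw hn h)).
Proof.
have sm := scv_smooth hX.
(* With n = m + 2, the degrees 0 and 1 exist in [tpoly n] as [ord0] and [lift ord0 ord0]. *)
case: n hn => [|[|m]] hn //; split; first split.
- exact: Defs.iotaD.
- exact: iota_res.
- exact: iota_inj.
- move=> U a; split=> [|[D <-]]; [exact: tau_ker | exact: tau_iotaT].
move=> I U_ h L cov hP [pi piP].
exists (Ltw (fun i j => ccoef h i j ^+ m.+2)).
  exact: is_tensor_power_conormal piP _ cov.
exact: is_tensor_TXtw.
Qed.
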